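(* Assume one of the following: (i) $\mathcal X_0,\mathcal X_1$ are finite sets, $\mu_0,\mu_1$ are probability measures on them, $\kappa_0:\mathcal X_0\times\mathcal X_0\to\mathbb R$ and $\kappa_1:\mathcal X_1\times\mathcal X_1\to\mathbb R$ are both PSD or both NSD kernels, and $q\in\mathbb N\setminus\{0\}$; or (ii) $\mathcal X_i=\mathbb R^{d_i}$, $\kappa_i(x,x')=\|x-x'\|$, $\mu_i$ is a finitely supported centered (mean zero) probability measure on $\mathbb R^{d_i}$ for $i\in\{0,1\}$, and $q=2$. Assume also that $x\mapsto-\frac12x^{\intercal}\mathrm Mx$ is nonconstant on $\mathcal K$. With $R_1,R_{\mathsf H},\alpha,\gamma,\Delta$ as defined in the context, set $$C_1=2R_1e^{(R_1+R_{\mathsf H})/R_1},\quad C_2=\frac{\Delta}{2R_1},\quad C_1'=\max\{4R_1^2\|\mathrm Q\|_{\mathrm{op}},2\|c\|R_1\}\,e^{(R_1+R_{\mathsf H})/R_1},$$ $$\bar\varepsilon=\min\left\{\frac{\alpha}{R_{\mathsf H}},\frac{\gamma^2}{8R_{\mathsf H}},\frac{\Delta}{R_1+R_{\mathsf H}}\right\}.$$ Then for every $0<\varepsilon<\bar\varepsilon$: if $x^\star_\varepsilon$ solves $\min_{x\in\mathcal K}\{-\frac12x^{\intercal}\mathrm Mx-\varepsilon\mathsf H(x)\}$, $$\operatorname{dist}\left(x^\star_\varepsilon,\operatorname{argmin}_{x\in\mathcal K}\left\{-\tfrac12x^{\intercal}\mathrm Mx\right\}\right)\le C_1\exp(-C_2/\varepsilon);$$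 and if $\pi^\star_\varepsilon$ attains the infimum defining $\mathsf{EGW}^\varepsilon_{2,q}(\mu_0,\mu_1)$, $$0\le\iint\left|\kappa_0^q(x,x')-\kappa_1^q(y,y')\right|^2d\pi^\star_\varepsilon(x,y)\,d\pi^\star_\varepsilon(x',y')-\mathsf{GW}_{2,q}^2(\mu_0,\mu_1)\le C_1'\exp(-C_2/\varepsilon).$$
   Context: A PSD (resp. NSD) kernel $k$ on $\mathcal X$ is a symmetric function such that for every finite tuple $(x_1,\dots,x_s)$ the matrix $(k(x_l,x_m))_{l,m}$ is positive (resp. negative) semidefinite. Let $x_0^{(1)},\dots,x_0^{(N_0)}$ and $x_1^{(1)},\dots,x_1^{(N_1)}$ be the points of $\mathcal X_0,\mathcal X_1$ in case (i), or the support points of $\mu_0,\mu_1$ in case (ii). With $\Pi(\mu_0,\mu_1)$ the set of couplings, $$\mathsf{GW}_{2,q}(\mu_0,\mu_1)=\left(\inf_{\pi\in\Pi(\mu_0,\mu_1)}\iint|\kappa_0^q(x,x')-\kappa_1^q(y,y')|^2d\pi(x,y)d\pi(x',y')\right)^{1/2},$$ $$\mathsf{EGW}^\varepsilon_{2,q}(\mu_0,\mu_1)=\inf_{\pi\in\Pi(\mu_0,\mu_1)}\iint|\kappa_0^q(x,x')-\kappa_1^q(y,y')|^2d\pi(x,y)d\pi(x',y')-\varepsilon\mathsf H(\pi),$$ $\mathsf H(\pi)=-\sum\pi(\{(x_0,x_1)\})\log\pi(\{(x_0,x_1)\})$ (sum over pairs of points, $0\log0=0$). For vectors, $\mathsf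 H(x)=-\sum_ix_i\log x_i$ if $x\ge0$, $-\infty$ otherwise. Let $n=N_0N_1$. Couplings are identified with $x=\operatorname{vec}(\mathrm P)\in\mathbb R^n$ (stacking columns), $\mathrm P\in\mathbb R^{N_1\times N_0}$, $\mathrm P_{lm}=\pi(\{(x_0^{(m)},x_1^{(l)})\})$; coordinates of $x$ are thus indexed by pairs $(m,l)$. $\mathcal K=\{x\in\mathbb R^n:\mathrm Ax=b,x\ge0\}$ is the resulting polytope of couplings, where $\mathrm Ax=b$ encodes that for each $m$ the coordinates $(m,\cdot)$ sum to $\mu_0(\{x_0^{(m)}\})$ and for each $l$ the coordinates $(\cdot,l)$ sum to $\mu_1(\{x_1^{(l)}\})$. $$\mathrm M=4\left(\kappa_0^q(x_0^{(i)},x_0^{(j)})\right)_{i,j=1}^{N_0}\otimes\left(\kappa_1^q(x_1^{(i)},x_1^{(j)})\right)_{i,j=1}^{N_1}\in\mathbb R^{n\times n}$$ (Kronecker product). Data used for the constants: a PSD matrix $\mathrm Q\in\mathbb R^{n\times n}$ and $c\in\mathbb R^n$. In case (i), $\mathrm Q=\mathrm M$ and $c=0$. In case (ii), $\mathrm Q_{(m,l),(m',l')}=16\,\langle x_0^{(m)},x_0^{(m')}\rangle\langle x_1^{(l)},x_1^{(l')}\rangle$ and $c_{(m,l)}=-4\|x_0^{(m)}\|^2\|x_1^{(l)}\|^2$ (in this case $-\frac12x^{\intercal}\mathrm Mx$ and $-\frac12x^{\intercal}\mathrm Qx+c^{\intercal}x$ differ by a constant on $\mathcal K$). Fix $\mathrm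 B\in\mathbb R^{r\times n}$, $r\le n$, with $\mathrm Q=\mathrm B^{\intercal}\mathrm B$. Let $\mathcal V(\mathcal K)=\{v^{(i)}\}_{i=1}^V$ be the vertices of $\mathcal K$, $[V]=\{1,\dots,V\}$; $R_{\mathsf H}=\max_{x,x'\in\mathcal K}\{\mathsf H(x)-\mathsf H(x')\}$, $R_1=\max_{x\in\mathcal K}\|x\|_1$; $\mathcal C_i=\{u\in\mathbb R^r:(c-\mathrm B^{\intercal}u)^{\intercal}v^{(i)}\le(c-\mathrm B^{\intercal}u)^{\intercal}v^{(j)}\ \forall j\ne i\}$; $g_0(u)=\frac12\|u\|^2+\min_{x\in\mathcal K}(c-\mathrm B^{\intercal}u)^{\intercal}x$; for $d\in\mathbb R^n$, $\mathcal O_d=\operatorname{argmin}_{x\in\mathcal K}d^{\intercal}x$ and $\kappa_d=\min_{x\in\mathcal V(\mathcal K)\setminus\mathcal O_d}d^{\intercal}x-\min_{x\in\mathcal O_d}d^{\intercal}x$; $\mathcal I^\star=\{i\in[V]:\mathcal C_i\cap\operatorname{argmin}_{\mathbb R^r}g_0\ne\emptyset\}$; $\alpha=\min_{u\in\bigcup_{i\in[V]\setminus\mathcal I^\star}\mathcal C_i}g_0(u)-\min_{\mathbb R^r}g_0$; $\gamma_i=\operatorname{dist}(\mathrm Bv^{(i)},\operatorname{bd}(\mathcal C_i))$; $\Delta_i=\min\{\kappa_{c-\mathrm B^{\intercal}\mathrm Bv^{(i)}},\frac{\gamma_i}2\min_{k:\mathrm Bv^{(k)}\ne\mathrm Bv^{(i)}}\|\mathrm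 Bv^{(k)}-\mathrm Bv^{(i)}\|\}$; $\gamma=\min_{i\in\mathcal I^\star}\gamma_i$, $\Delta=\min_{i\in\mathcal I^\star}\Delta_i$. Minima/infima over empty sets are $+\infty$; norms and $\operatorname{dist}$ are Euclidean, $\|\cdot\|_{\mathrm{op}}$ is the operator norm. *)

(* Defs.v *)
From HB Require Import structures.
From mathcomp Require Import all_boot all_order all_algebra.
From mathcomp Require Import all_classical all_reals all_analysis.
From mathcomp Require Export mxtens.

Set Implicit Arguments.
Unset Strict Implicit.
Unset Printing Implicit Defensive.

Import Order.TTheory GRing.Theory Num.Theory.
Import numFieldNormedType.Exports.

Local Open Scope classical_set_scope.
Local Open Scope ring_scope.

(* The norm carried by the library instance on 'cV[R]_n is the sup norm, hence
   the explicit Euclidean norm.  The two norms induce the same topology, so the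
   library's closure, interior and open sets are the usual ones. *)

Definition dotv (R : realType) (n : nat) (x y : 'cV[R]_n) : R :=
  (x^T *m y) 0 0.

Definition enorm (R : realType) (n : nat) (x : 'cV[R]_n) : R :=
  Num.sqrt (dotv x x).

Definition norm1 (R : realType) (n : nat) (x : 'cV[R]_n) : R :=
  \sum_(i < n) `|x i 0|.

Definition quad (R : realType) (n : nat) (A : 'M[R]_n) (x : 'cV[R]_n) : R :=
  (x^T *m A *m x) 0 0.

Definition opnorm (R : realType) (m n : nat) (A : 'M[R]_(m, n)) : R :=
  sup [set enorm (A *m x) | x in [set x : 'cV[R]_n | enorm x <= 1]].

Definition dist (R : realType) (n : nat) (x : 'cV[R]_n) (A : set 'cV[R]_n) :
    \bar R :=
  ereal_inf [set (enorm (x - y))%:E | y in A].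

Definition bd (T : topologicalType) (A : set T) : set T := closure A `\` A°.

Definition argmin (R : realType) (T : Type) (A : set T) (f : T -> R) : set T :=
  [set x | A x /\ forall y, A y -> f x <= f y].

Definition vertices (R : realType) (n : nat) (K : set 'cV[R]_n) :
    set 'cV[R]_n :=
  [set x | K x /\ forall (y z : 'cV[R]_n) (t : R), K y -> K z -> 0 < t < 1 ->
    x = t *: y + (1 - t) *: z -> y = x /\ z = x].

(* Only evaluated at vectors with nonnegative coordinates, so the value -oo that
   the entropy takes elsewhere is not encoded.  Here ln 0 = 0, so 0 ln 0 = 0. *)
Definition entropy (R : realType) (n : nat) (x : 'cV[R]_n) : R :=
  - \sum_(i < n) x i 0 * ln (x i 0).

Definition psd_mx (R : realType) (n : nat) (A : 'M[R]_n) : Prop :=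
  A^T = A /\ forall x : 'cV[R]_n, 0 <= quad A x.

Definition nsd_mx (R : realType) (n : nat) (A : 'M[R]_n) : Prop :=
  A^T = A /\ forall x : 'cV[R]_n, quad A x <= 0.

Definition kernel_mx (R : realType) (X : Type) (k : X -> X -> R) (s : nat)
    (x : 'I_s -> X) : 'M[R]_s :=
  \matrix_(l, m) k (x l) (x m).

Definition psd_kernel (R : realType) (X : Type) (k : X -> X -> R) : Prop :=
  (forall x y, k x y = k y x) /\
  forall (s : nat) (x : 'I_s -> X), psd_mx (kernel_mx k x).

Definition nsd_kernel (R : realType) (X : Type) (k : X -> X -> R) : Prop :=
  (forall x y, k x y = k y x) /\
  forall (s : nat) (x : 'I_s -> X), nsd_mx (kernel_mx k x).

Section GromovWasserstein.
Context (R : realType) (d0 d1 : measure_display).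
Context (X0 : measurableType d0) (X1 : measurableType d1).
Context (k0 : X0 -> X0 -> R) (k1 : X1 -> X1 -> R) (q : nat).
Context (mu0 : probability X0 R) (mu1 : probability X1 R).

Definition coupling : set (probability (X0 * X1)%type R) :=
  [set pi | (forall A, measurable A -> pi (A `*` setT) = mu0 A) /\
            (forall B, measurable B -> pi (setT `*` B) = mu1 B)].

Definition gw_cost (pi : probability (X0 * X1)%type R) : \bar R :=
  (\int[pi]_z \int[pi]_z'
    (`|k0 z.1 z'.1 ^+ q - k1 z.2 z'.2 ^+ q| ^+ 2)%:E)%E.

Definition GW : \bar R := poweR (ereal_inf [set gw_cost pi | pi in coupling]) 2^-1.

Context (N0 N1 : nat) (x0 : 'I_N0 -> X0) (x1 : 'I_N1 -> X1).

(* The pair (m, l) is the coordinate mxtens_index (m, l) = m * N1 + l, which is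
   the order obtained by stacking the columns of an N1 x N0 matrix. *)

Definition coupling_vec (pi : probability (X0 * X1)%type R) :
    'cV[R]_(N0 * N1) :=
  \col_k fine (pi [set (x0 (mxtens_unindex k).1, x1 (mxtens_unindex k).2)]).

Definition egw_objective (eps : R) (pi : probability (X0 * X1)%type R) :
    \bar R :=
  (gw_cost pi - (eps * entropy (coupling_vec pi))%:E)%E.

Definition EGW (eps : R) : \bar R :=
  ereal_inf [set egw_objective eps pi | pi in coupling].

Definition polytope : set 'cV[R]_(N0 * N1) :=
  [set x | [/\ forall k, 0 <= x k 0,
    forall m, \sum_(l < N1) x (mxtens_index (m, l)) 0 = fine (mu0 [set x0 m])
  & forall l, \sum_(m < N0) x (mxtens_index (m, l)) 0 = fine (mu1 [set x1 l])]].

Definition Mmx : 'M[R]_(N0 * N1) :=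
  4 *: tensmx (kernel_mx (fun x y => k0 x y ^+ q) x0)
              (kernel_mx (fun x y => k1 x y ^+ q) x1).

End GromovWasserstein.

(* A copy of 'cV[R]_d measurable for its Borel sigma-algebra, which the library
   does not put on 'cV[R]_d itself. *)
Definition Rd_display (R : realType) (d : nat) : measure_display :=
  sigma_display (@open 'cV[R]_d).

Definition Rd (R : realType) (d : nat) : measurableType (Rd_display R d) :=
  g_sigma_algebraType (@open 'cV[R]_d).

Definition euclidean_kernel (R : realType) (d : nat) (x y : Rd R d) : R :=
  enorm ((x : 'cV[R]_d) - (y : 'cV[R]_d)).

Definition centered (R : realType) (d : nat) (mu : probability (Rd R d) R) :
    Prop :=
  forall i : 'I_d,
    mu.-integrable setT (fun x : Rd R d => ((x : 'cV[R]_d) i 0)%:E) /\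
    (\int[mu]_x ((x : 'cV[R]_d) i 0)%:E = 0)%E.

(* This also says that mu is finitely supported. *)
Definition support_points (R : realType) (d : nat) (mu : probability (Rd R d) R)
    (N : nat) (x : 'I_N -> Rd R d) : Prop :=
  [/\ injective x, forall m, (0 < mu [set x m])%E & mu (range x) = 1%E].

Definition gram (R : realType) (d N : nat) (x : 'I_N -> Rd R d) : 'M[R]_N :=
  \matrix_(m, m') dotv (x m : 'cV[R]_d) (x m' : 'cV[R]_d).

Definition finite_discrete (d : measure_display) (X : measurableType d) : Prop :=
  finite_set [set: X] /\ forall A : set X, measurable A.

(* Q and c are indices because each setting determines them: Q = M and c = 0 in
   the first; in the second, -1/2 x^T M x and -1/2 x^T Q x + c^T x differ by a
   constant on the polytope. *)
Inductive gw_setting (R : realType) :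
  forall (d0 d1 : measure_display)
    (X0 : measurableType d0) (X1 : measurableType d1)
    (k0 : X0 -> X0 -> R) (k1 : X1 -> X1 -> R) (q : nat)
    (mu0 : probability X0 R) (mu1 : probability X1 R)
    (N0 N1 : nat) (x0 : 'I_N0 -> X0) (x1 : 'I_N1 -> X1)
    (Q : 'M[R]_(N0 * N1)) (c : 'cV[R]_(N0 * N1)), Prop :=
| finite_setting (d0 d1 : measure_display)
    (X0 : measurableType d0) (X1 : measurableType d1)
    (k0 : X0 -> X0 -> R) (k1 : X1 -> X1 -> R) (q : nat)
    (mu0 : probability X0 R) (mu1 : probability X1 R)
    (N0 N1 : nat) (x0 : 'I_N0 -> X0) (x1 : 'I_N1 -> X1) :
    finite_discrete X0 -> finite_discrete X1 ->
    (psd_kernel k0 /\ psd_kernel k1) \/ (nsd_kernel k0 /\ nsd_kernel k1) ->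
    (0 < q)%N ->
    bijective x0 -> bijective x1 ->
    gw_setting k0 k1 q mu0 mu1 x0 x1 (Mmx k0 k1 q x0 x1) 0
| euclidean_setting (n0 n1 : nat)
    (mu0 : probability (Rd R n0) R) (mu1 : probability (Rd R n1) R)
    (N0 N1 : nat) (x0 : 'I_N0 -> Rd R n0) (x1 : 'I_N1 -> Rd R n1) :
    centered mu0 -> centered mu1 ->
    support_points mu0 x0 -> support_points mu1 x1 ->
    gw_setting (@euclidean_kernel R n0) (@euclidean_kernel R n1) 2
      mu0 mu1 x0 x1
      (16 *: tensmx (gram x0) (gram x1))
      (\col_k (- 4 * enorm (x0 (mxtens_unindex k).1 : 'cV[R]_n0) ^+ 2
                   * enorm (x1 (mxtens_unindex k).2 : 'cV[R]_n1) ^+ 2)).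

(* Minima and infima that may range over an empty set, and the quantities built
   from them, are taken in \bar R, where ereal_inf set0 = +oo. *)
Section Constants.
Context (R : realType) (n r nV : nat) (K : set 'cV[R]_n).
Context (c : 'cV[R]_n) (B : 'M[R]_(r, n)) (v : 'I_nV -> 'cV[R]_n).

Definition R_H : R :=
  sup [set h | exists x y, [/\ K x, K y & h = entropy x - entropy y]].

Definition R_1 : R := sup [set norm1 x | x in K].

Definition cone (i : 'I_nV) : set 'cV[R]_r :=
  [set u | forall j, j != i ->
    dotv (c - B^T *m u) (v i) <= dotv (c - B^T *m u) (v j)].

Definition g_0 (u : 'cV[R]_r) : R :=
  2^-1 * enorm u ^+ 2 + inf [set dotv (c - B^T *m u) x | x in K].

Definition lp_argmin (d : 'cV[R]_n) : set 'cV[R]_n := argmin K (dotv d).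

Definition lp_gap (d : 'cV[R]_n) : \bar R :=
  (ereal_inf [set (dotv d x)%:E | x in vertices K `\` lp_argmin d]
   - ereal_inf [set (dotv d x)%:E | x in lp_argmin d])%E.

Definition Istar : set 'I_nV := [set i | cone i `&` argmin setT g_0 !=set0].

Definition alpha : \bar R :=
  (ereal_inf [set (g_0 u)%:E | u in \bigcup_(i in ~` Istar) cone i]
   - ereal_inf [set (g_0 u)%:E | u in setT])%E.

Definition gamma_ (i : 'I_nV) : \bar R := dist (B *m v i) (bd (cone i)).

Definition Delta_ (i : 'I_nV) : \bar R :=
  Order.min (lp_gap (c - B^T *m (B *m v i)))
    (gamma_ i * (2^-1)%:E *
     ereal_inf [set (enorm (B *m v k - B *m v i))%:E
               | k in [set k | B *m v k <> B *m v i]])%E.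

Definition gamma : \bar R := ereal_inf [set gamma_ i | i in Istar].

Definition Delta : \bar R := ereal_inf [set Delta_ i | i in Istar].

Definition C_2 : \bar R := (Delta * ((2 * R_1)^-1)%:E)%E.

Definition C_1 : R := 2 * R_1 * expR ((R_1 + R_H) / R_1).

Definition C_1' (Q : 'M[R]_n) : R :=
  Num.max (4 * R_1 ^+ 2 * opnorm Q) (2 * enorm c * R_1)
  * expR ((R_1 + R_H) / R_1).

Definition eps_bar : \bar R :=
  Order.min (alpha * (R_H^-1)%:E)%E
    (Order.min (gamma ^+ 2 * ((8 * R_H)^-1)%:E)%E
               (Delta * ((R_1 + R_H)^-1)%:E)%E).

End Constants.

(* Main.v *)
Require Import Defs.
From mathcomp Require Import all_boot all_order all_algebra.
From mathcomp Require Import all_classical all_reals all_analysis.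
From mathcomp Require Import measurable_realfun ring lra.

Set Implicit Arguments.
Unset Strict Implicit.
Unset Printing Implicit Defensive.

Import Order.TTheory GRing.Theory Num.Theory.
Import numFieldNormedType.Exports.

Local Open Scope classical_set_scope.
Local Open Scope ring_scope.

(** Write [F x = c.x - |B x|^2 / 2]; on the polytope [K] of couplings the objective
    [- x^T M x / 2] equals [F] up to a constant, and so does the Gromov-Wasserstein
    cost of a coupling.  Everything reduces to the concave quadratic programme
    [min F] over [K] with the penalty [- eps * entropy].

    Concavity allows [F x] to be written as the minimum over [u] of the joint
    objective [|u|^2 / 2 + (c - B^T u).x], attained at [u = B x].  Hence a minimiser
    [x] of the penalised problem is, for [u = B x] fixed, also the solution of a
    penalised linear programme with cost [c - B^T u]; and exchanging the two
    minimisations turns [min F] into [min g_0], where [g_0] is on the cone of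
    vertex [v i], up to a constant, half the squared distance to [B v i].  The
    penalty moves values by at most [eps * R_H].  With [eps * R_H < alpha] this
    confines [u] to the cones that contain a minimiser of [g_0]
    ([alpha_Istar]), in which case this minimiser is [B v i] and [v i] minimises [F]
    ([IstarP]); with [8 * eps * R_H < gamma^2] it brings [u] within half the distance
    from [B v i] to the boundary of its cone ([gamma_dist]).  There the optimal
    vertices of the linear programme are those of the programme at [B v i], all
    minimisers of [F], and the other vertices are worse by at least [Delta]
    ([Delta_le]).

    It remains to see that the solution of an entropically penalised linear
    programme with gap [Delta] puts an exponentially small mass [l] on the vertices
    that are not optimal.  By [entropy_mixture], removing this mass costs an entropy
    of at most [l * (R_1 + R_H - R_1 * ln l)], and it gains [l * Delta] in linear cost,
    so [Delta <= eps * (R_1 + R_H - R_1 * ln l)] ([entropic_mass_le]).  That every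
    point of [K] is a mixture of vertices is Minkowski's theorem
    ([polytope_sub_hull]).  The resulting rate [Delta / (R_1 * eps)] is twice the one
    claimed; the spare half absorbs a constant in the second estimate
    ([mass_decay], [cost_rate]).

    On the side of measures, every coupling is carried by the grid of pairs of
    points, so that integrals are finite sums ([ge0_integral_atoms]) and couplings
    correspond to points of [K] ([coupling_vec_polytope], [polytope_coupling]).  For
    Euclidean distances, centring cancels all the terms of the cost that could
    spoil concavity ([euclidean_reduction]). *)

(** * Euclidean norm and operator norm *)

Section Euclidean.
Context (R : realType).
Implicit Types (m n : nat).

Lemma dotvE n (x y : 'cV[R]_n) : dotv x y = \sum_i x i 0 * y i 0.
Proof. by rewrite /dotv mxE; apply: eq_bigr => i _; rewrite !mxE. Qed.

Lemma dotvC n (x y : 'cV[R]_n) : dotv x y = dotv y x.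
Proof. by rewrite !dotvE; apply: eq_bigr => i _; rewrite mulrC. Qed.

Lemma dotvDr n (z x y : 'cV[R]_n) : dotv z (x + y) = dotv z x + dotv z y.
Proof. by rewrite /dotv mulmxDr mxE. Qed.

Lemma dotvZr n (z : 'cV[R]_n) a x : dotv z (a *: x) = a * dotv z x.
Proof. by rewrite /dotv -scalemxAr mxE. Qed.

Lemma dotvNr n (z x : 'cV[R]_n) : dotv z (- x) = - dotv z x.
Proof. by rewrite /dotv mulmxN mxE. Qed.

Lemma dotvBr n (z x y : 'cV[R]_n) : dotv z (x - y) = dotv z x - dotv z y.
Proof. by rewrite dotvDr dotvNr. Qed.

Lemma dotvDl n (z x y : 'cV[R]_n) : dotv (x + y) z = dotv x z + dotv y z.
Proof. by rewrite -!(dotvC z) dotvDr. Qed.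

Lemma dotvZl n (z : 'cV[R]_n) a x : dotv (a *: x) z = a * dotv x z.
Proof. by rewrite -!(dotvC z) dotvZr. Qed.

Lemma dotvNl n (z x : 'cV[R]_n) : dotv (- x) z = - dotv x z.
Proof. by rewrite -!(dotvC z) dotvNr. Qed.

Lemma dotvBl n (z x y : 'cV[R]_n) : dotv (x - y) z = dotv x z - dotv y z.
Proof. by rewrite dotvDl dotvNl. Qed.

Lemma dotv_sumr n (I : finType) (z : 'cV[R]_n) (x : I -> 'cV[R]_n) :
  dotv z (\sum_i x i) = \sum_i dotv z (x i).
Proof. by rewrite /dotv mulmx_sumr summxE. Qed.

Definition dotvD := (dotvDl, dotvDr, dotvBl, dotvBr, dotvNl, dotvNr, dotvZl, dotvZr).

Lemma dotv_trmx m n (B : 'M[R]_(m, n)) u x :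
  dotv (B^T *m u) x = dotv u (B *m x).
Proof. by rewrite /dotv trmx_mul trmxK mulmxA. Qed.

Lemma dotvv_ge0 n (x : 'cV[R]_n) : 0 <= dotv x x.
Proof. by rewrite dotvE sumr_ge0 // => i _; rewrite -expr2 sqr_ge0. Qed.

Lemma dotvv_eq0 n (x : 'cV[R]_n) : dotv x x = 0 -> x = 0.
Proof.
move=> /eqP; rewrite dotvE psumr_eq0 => [/allP h|i _]; last by rewrite -expr2 sqr_ge0.
apply/matrixP => i j; rewrite ord1 mxE; apply/eqP.
by have := h i (mem_index_enum _); rewrite mulf_eq0 orbb.
Qed.

Lemma sqr_enorm n (x : 'cV[R]_n) : enorm x ^+ 2 = dotv x x.
Proof. by rewrite sqr_sqrtr // dotvv_ge0. Qed.

Lemma quad_gram n r (B : 'M[R]_(r, n)) x :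
  quad (B^T *m B) x = enorm (B *m x) ^+ 2.
Proof. by rewrite sqr_enorm /quad /dotv trmx_mul -!mulmxA. Qed.

Lemma enorm_ge0 n (x : 'cV[R]_n) : 0 <= enorm x.
Proof. exact: sqrtr_ge0. Qed.

Lemma enorm_eq0 n (x : 'cV[R]_n) : enorm x = 0 -> x = 0.
Proof. by move=> x0; apply: dotvv_eq0; rewrite -sqr_enorm x0 expr0n. Qed.

Lemma enorm0 n : enorm (0 : 'cV[R]_n) = 0.
Proof. by rewrite /enorm /dotv mulmx0 mxE sqrtr0. Qed.

Lemma enormN n (x : 'cV[R]_n) : enorm (- x) = enorm x.
Proof. by rewrite /enorm !dotvD opprK. Qed.

Lemma enormZ n a (x : 'cV[R]_n) : enorm (a *: x) = `|a| * enorm x.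
Proof.
by rewrite /enorm !dotvD mulrA -expr2 sqrtrM ?sqr_ge0 // sqrtr_sqr.
Qed.

Lemma cauchy_schwarz n (x y : 'cV[R]_n) : `|dotv x y| <= enorm x * enorm y.
Proof.
have [y0|ypos] := eqVneq (dotv y y) 0.
  by rewrite (dotvv_eq0 y0) /dotv mulmx0 mxE normr0 mulr_ge0 // sqrtr_ge0.
have {}ypos : 0 < dotv y y by rewrite lt_neqAle eq_sym ypos dotvv_ge0.
rewrite -ler_sqr ?nnegrE ?mulr_ge0 ?enorm_ge0 // exprMn !sqr_enorm -normrX.
rewrite ger0_norm ?sqr_ge0 // -(ler_pM2l ypos) -subr_ge0.
have := dotvv_ge0 (dotv y y *: x - dotv x y *: y).
rewrite !dotvD (dotvC y x); congr (_ <= _); ring.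
Qed.

Lemma enormD n (x y : 'cV[R]_n) : enorm (x + y) <= enorm x + enorm y.
Proof.
rewrite -ler_sqr ?nnegrE ?addr_ge0 ?enorm_ge0 // sqrrD !sqr_enorm !dotvD (dotvC y x).
have := le_trans (ler_norm _) (cauchy_schwarz x y); lra.
Qed.

Lemma enormB n (x y : 'cV[R]_n) : enorm (x - y) <= enorm x + enorm y.
Proof. by rewrite -(enormN y) enormD. Qed.

Lemma enorm_le_norm1 n (x : 'cV[R]_n) : enorm x <= norm1 x.
Proof.
have ge0 : 0 <= norm1 x by rewrite sumr_ge0.
rewrite -ler_sqr ?nnegrE ?enorm_ge0 // sqr_enorm dotvE expr2 {1}/norm1 mulr_suml.
apply: ler_sum => i _; rewrite -expr2 -real_normK ?num_real // expr2 ler_wpM2l //.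
by rewrite /norm1 (bigD1 i) //= lerDl sumr_ge0.
Qed.

(** The supremum that defines the operator norm is over a bounded set: each
    coordinate of [A *m x] is a scalar product of a row of [A] with [x], so the
    sum of the norms of the rows of [A] is an upper bound. *)
Lemma opnorm_ub m n (A : 'M[R]_(m, n)) x : enorm x <= 1 -> enorm (A *m x) <= opnorm A.
Proof.
move=> x1; apply: ub_le_sup; last by exists x.
exists (\sum_i enorm (row i A)^T) => _ [y /= y1 <-].
apply: le_trans (enorm_le_norm1 _) _; apply: ler_sum => i _.
apply: le_trans (_ : enorm (row i A)^T * enorm y <= _); last first.
  by rewrite ler_piMr // enorm_ge0.
apply: le_trans (cauchy_schwarz _ _); rewrite /dotv trmxK -row_mul !mxE.
exact: lexx.
Qed.

Lemma opnorm_ge0 m n (A : 'M[R]_(m, n)) : 0 <= opnorm A.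
Proof.
have := @opnorm_ub _ _ A 0; rewrite mulmx0 !enorm0; apply; exact: ler01.
Qed.

Lemma enorm_mulmx m n (A : 'M[R]_(m, n)) x : enorm (A *m x) <= opnorm A * enorm x.
Proof.
have [x0|x0] := eqVneq (enorm x) 0.
  by rewrite (enorm_eq0 x0) mulmx0 !enorm0 mulr0.
have {}x0 : 0 < enorm x by rewrite lt_neqAle eq_sym x0 enorm_ge0.
rewrite -ler_pdivrMr // mulrC -[_^-1]ger0_norm ?invr_ge0 ?enorm_ge0 //.
rewrite -enormZ scalemxAr; apply: opnorm_ub.
by rewrite enormZ ger0_norm ?invr_ge0 ?enorm_ge0 // mulVf // gt_eqF.
Qed.

End Euclidean.

(** * Polytopes and mixtures of vertices *)

Section Polytope.
Context (R : realType) (n nV : nat) (v : 'I_nV -> 'cV[R]_n).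
Implicit Types (x y z d : 'cV[R]_n) (P : pred 'I_nV).

Definition hull P : set 'cV[R]_n :=
  [set x | exists w : 'I_nV -> R, [/\ forall i, 0 <= w i, \sum_i w i = 1,
     forall i, ~~ P i -> w i = 0 & x = \sum_i w i *: v i]].

Lemma hull_point P i : P i -> hull P (v i).
Proof.
move=> Pi; exists (fun j => (j == i)%:R); split => [j||j|].
- by rewrite ler0n.
- by rewrite (bigD1 i) //= eqxx big1 ?addr0 // => j /negPf ->.
- by apply: contraNeq; case: (eqVneq j i) => [->|_]; rewrite ?eqxx.
- rewrite (bigD1 i) //= eqxx scale1r big1 ?addr0 // => j /negPf ->.
  by rewrite scale0r.
Qed.

Lemma hull_convex P t x y : 0 <= t <= 1 -> hull P x -> hull P y ->
  hull P (t *: x + (1 - t) *: y).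
Proof.
move=> /andP[t0 t1] [w [w0 w1 wP ->]] [w' [w'0 w'1 w'P ->]].
exists (fun i => t * w i + (1 - t) * w' i); split => [i||i Pi|].
- by rewrite addr_ge0 ?mulr_ge0 ?subr_ge0.
- by rewrite big_split /= -!mulr_sumr w1 w'1; ring.
- by rewrite wP // w'P // !mulr0 addr0.
- under [RHS]eq_bigr do rewrite scalerDl -!scalerA.
  by rewrite big_split /= -!scaler_sumr.
Qed.

Lemma hull_sub P P' : {subset P <= P'} -> hull P `<=` hull P'.
Proof.
move=> PP' x [w [w0 w1 wP xE]]; exists w; split => // i P'i.
by apply: wP; apply: contra P'i; apply: PP'.
Qed.

Lemma hull_dotv_ge P d a x : (forall i, P i -> a <= dotv d (v i)) ->
  hull P x -> a <= dotv d x.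
Proof.
move=> h [w [w0 w1 wP ->]]; rewrite dotv_sumr -(mul1r a) -w1 mulr_suml.
apply: ler_sum => i _; rewrite dotvZr.
have [Pi|/wP ->] := boolP (P i); last by rewrite !mul0r.
by rewrite ler_wpM2l // h.
Qed.

Lemma hull_mulmx m (A : 'M[R]_(m, n)) P b x : (forall i, P i -> A *m v i = b) ->
  hull P x -> A *m x = b.
Proof.
move=> h [w [w0 w1 wP ->]]; rewrite mulmx_sumr -[RHS]scale1r -w1 scaler_suml.
apply: eq_bigr => i _; rewrite -scalemxAr.
by have [/h ->|/wP ->] := boolP (P i); rewrite ?scale0r.
Qed.

Lemma hull_dotv P d a x : (forall i, P i -> dotv d (v i) = a) ->
  hull P x -> dotv d x = a.
Proof.
move=> h hx; suff: d^T *m x = a%:M by rewrite /dotv => ->; rewrite mxE mulr1n.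
apply: (hull_mulmx _ hx) => i /h <-.
by apply/matrixP => k l; rewrite !ord1 [RHS]mxE eqxx mulr1n.
Qed.

(** Collecting the weights in and outside [P] exhibits a point of the hull as a
    mixture; the mass [l] outside [P] is what the entropic penalty controls. *)
Lemma hull_split P i0 x : P i0 -> hull predT x ->
  exists l y z, [/\ 0 <= l <= 1, x = (1 - l) *: y + l *: z,
    hull P y, hull predT z & l != 0 -> hull (predC P) z].
Proof.
move=> Pi0 hx; have [w [w0 w1 _ xE]] := hx.
pose l := \sum_(i | ~~ P i) w i.
have l0 : 0 <= l by rewrite sumr_ge0.
have lE : \sum_(i | P i) w i = 1 - l by rewrite -w1 [in RHS](bigID P) /= addrK.
have l1 : l <= 1 by rewrite -subr_ge0 -lE sumr_ge0.
have part (S : pred 'I_nV) (s : R) : \sum_(i | S i) w i = s -> s != 0 ->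
    hull S (s^-1 *: \sum_(i | S i) w i *: v i).
  move=> sE s0; exists (fun i => if S i then s^-1 * w i else 0); split => [i||i|].
  - by case: ifP => // _; rewrite mulr_ge0 // invr_ge0 -sE sumr_ge0.
  - by rewrite -big_mkcond -mulr_sumr sE mulVf.
  - by case: ifP.
  - rewrite big_mkcond scaler_sumr; apply: eq_bigr => i _ /=.
    by case: ifP => _; rewrite ?scalerA // scale0r scaler0.
have [l_eq0|l_neq0] := eqVneq l 0.
  exists 0, x, x; split => //; rewrite ?lexx ?ler01 ?subr0 ?scale1r ?scale0r ?addr0 ?eqxx //.
  exists w; split => // i Pi; apply/eqP; move/eqP: l_eq0.
  rewrite psumr_eq0 => [/allP/(_ i (mem_index_enum _))|//]; by rewrite Pi.
have hz := part (predC P) l erefl l_neq0.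
have hzT : hull predT (l^-1 *: \sum_(i | predC P i) w i *: v i) by apply: hull_sub hz.
have [l_eq1|l_neq1] := eqVneq (1 - l) 0.
  exists 1, (v i0), x; split; rewrite ?lexx ?ler01 ?subrr ?scale0r ?scale1r ?add0r //.
    exact: hull_point.
  move=> _; exists w; split => // i; rewrite /= negbK => Pi; apply/eqP.
  have /eqP := etrans lE l_eq1; rewrite psumr_eq0 => [/allP/(_ i (mem_index_enum _))|//].
  by rewrite Pi.
exists l, ((1 - l)^-1 *: \sum_(i | P i) w i *: v i),
  (l^-1 *: \sum_(i | predC P i) w i *: v i); split.
- by rewrite l0.
- by rewrite !scalerA !mulfV // !scale1r xE (bigID P).
- exact: part.
- exact: hzT.
- by move=> _.
Qed.

Lemma argmin_vertex d (i0 : 'I_nV) :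
  exists i, forall x, hull predT x -> dotv d (v i) <= dotv d x.
Proof.
have [i _ h] := Order.TotalTheory.arg_minP (fun i => dotv d (v i)) (isT : predT i0).
by exists i => x; apply: hull_dotv_ge => j _; apply: h.
Qed.

Context (p : nat) (A : 'M[R]_(p, n)) (b : 'cV[R]_p) (s : R) (K : set 'cV[R]_n).
Hypothesis KP : forall x, K x <-> (forall k, 0 <= x k 0) /\ A *m x = b.
Hypothesis massK : forall x, K x -> \sum_k x k 0 = s.

Lemma hull_subK : (forall i, K (v i)) -> hull predT `<=` K.
Proof.
move=> Kv x hx; apply/KP; split => [k|]; last first.
  by apply: hull_mulmx hx => i _; have [_] := (KP (v i)).1 (Kv i).
have [w [w0 _ _ ->]] := hx; rewrite summxE sumr_ge0 // => i _; rewrite mxE.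
by rewrite mulr_ge0 //; have [] := (KP (v i)).1 (Kv i).
Qed.

(** Of the coordinates that decrease along [w], the first to vanish determines the
    step; it was not zero at [x], because [w] vanishes where [x] does. *)
Lemma ray_exit x w : K x -> A *m w = 0 ->
  (forall k, x k 0 = 0 -> w k 0 = 0) -> (exists k, w k 0 < 0) ->
  exists2 t, 0 < t & K (x + t *: w) /\
    exists k, x k 0 != 0 /\ (x + t *: w) k 0 = 0.
Proof.
move=> Kx Aw0 sup [k0 wk0]; have [x0 Ax] := (KP x).1 Kx.
have [k wk kmin] :=
  Order.TotalTheory.arg_minP (fun k => x k 0 / - w k 0) (wk0 : (fun k => w k 0 < 0) k0).
have xk : x k 0 != 0 by apply: contraTneq wk => /sup ->; rewrite ltxx.
pose t := x k 0 / - w k 0; have t0 : 0 < t.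
  by apply: divr_gt0; rewrite ?oppr_gt0 // lt_neqAle eq_sym xk x0.
exists t => //; split.
  apply/KP; split => [j|]; last by rewrite mulmxDr -scalemxAr Aw0 scaler0 addr0.
  rewrite !mxE; have [wj|wj] := ltP (w j 0) 0; last first.
    by apply: addr_ge0; rewrite ?x0 // mulr_ge0 // ltW.
  by have := kmin j wj; rewrite -/t ler_pdivlMr ?oppr_gt0 // mulrN -subr_ge0 opprK.
by exists k; split => //; rewrite !mxE /t; field; rewrite lt_eqF.
Qed.

(** Minkowski's theorem.  A point [x] of [K] that is not a vertex lies inside a
    segment of [K]; following its line both ways until a coordinate vanishes
    writes [x] as a convex combination of two points with smaller supports.  The
    line does leave [K] in both directions, because the coordinates of its
    direction add up to zero. *)
Lemma polytope_sub_hull : vertices K `<=` range v -> K `<=` hull predT.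
Proof.
move=> Vv x; have [m] := ubnP #|[pred k | x k 0 != 0]|.
elim: m x => // m IH x xm Kx; rewrite ltnS in xm.
have [x0 Ax] := (KP x).1 Kx.
have [/Vv[i _ <-]|nV_x] := pselect (vertices K x); first exact: hull_point.
have [y [z [t [Ky Kz /andP[t0 t1] xE yz]]]] : exists y z t,
    [/\ K y, K z, 0 < t < 1, x = t *: y + (1 - t) *: z & y <> z].
  apply: contrapT => nex; apply: nV_x; split => // y z t Ky Kz t01 xE.
  have [yz|yz] := pselect (y = z); last by case: nex; exists y, z, t.
  by move: xE; rewrite -yz -scalerDl addrC subrK scale1r.
have [y0 Ay] := (KP y).1 Ky; have [z0 Az] := (KP z).1 Kz.
have exit w : A *m w = 0 -> (forall k, x k 0 = 0 -> w k 0 = 0) ->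
    \sum_k w k 0 = 0 -> w != 0 ->
    exists2 t, 0 < t & hull predT (x + t *: w).
  move=> Aw sw sumw w0.
  have [|e e0 [Ke [k [xk ek]]]] := ray_exit Kx Aw sw.
    apply: contrapT => nex; move/eqP: w0; apply; apply/matrixP => k j.
    have w0 i : 0 <= w i 0 by rewrite leNgt; apply/negP => wi; apply: nex; exists i.
    rewrite ord1 mxE; apply/eqP; move/eqP: sumw.
    by rewrite psumr_eq0 // => /allP/(_ k (mem_index_enum _)).
  exists e => //; apply: IH => //; apply: leq_trans xm.
  apply: proper_card; apply/properP; split.
    apply/fintype.subsetP => j; rewrite !inE; apply: contra => /eqP xj.
    by rewrite !mxE sw // xj mulr0 addr0.
  by exists k; rewrite !inE // ek eqxx.
pose w := y - z.
have w0 : w != 0 by rewrite subr_eq0; apply/eqP.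
have Aw : A *m w = 0 by rewrite mulmxBr Ay Az subrr.
have sw k : x k 0 = 0 -> w k 0 = 0.
  rewrite xE !mxE => /eqP; rewrite paddr_eq0 ?mulr_ge0 ?subr_ge0 // ?(ltW t0) ?(ltW t1) //.
  rewrite !mulf_eq0 (gt_eqF t0) subr_eq0 (gt_eqF t1) /= => /andP[/eqP yk /eqP zk].
  by rewrite yk zk subrr.
have sumw : \sum_k w k 0 = 0.
  rewrite (eq_bigr (fun k => y k 0 - z k 0)) => [|k _]; last by rewrite !mxE.
  by rewrite sumrB !massK // subrr.
have [e e0 he] := exit w Aw sw sumw w0.
have [||||f f0 hf] := exit (- w).
- by rewrite mulmxN Aw oppr0.
- by move=> k /sw wk; rewrite mxE wk oppr0.
- by under eq_bigr do rewrite mxE; rewrite sumrN sumw oppr0.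
- by rewrite oppr_eq0.
have ef : e + f != 0 by rewrite gt_eqF // addr_gt0.
have -> : x = (f / (e + f)) *: (x + e *: w) + (1 - f / (e + f)) *: (x + f *: - w).
  by apply/matrixP => k j; rewrite !mxE; field.
apply: hull_convex => //; rewrite divr_ge0 ?addr_ge0 ?(ltW e0) ?(ltW f0) //=.
by rewrite ler_pdivrMr ?addr_gt0 // mul1r lerDr ltW.
Qed.

End Polytope.

(** * Entropy and penalised linear programming *)

Section Entropy.
Context (R : realType) (n : nat).
Implicit Types (x y z d : 'cV[R]_n).

Lemma xlnx_ge (m c w : R) : 0 <= m -> 0 <= c -> m * c <= w ->
  m * c * (ln m + ln c) <= m * c * ln w.
Proof.
move=> m0 c0 mcw; have [/eqP mc0|mc0] := eqVneq (m * c) 0.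
  by rewrite (eqP mc0) !mul0r.
have mc : 0 < m * c by rewrite lt_neqAle eq_sym mc0 mulr_ge0.
move: mc0; rewrite mulf_eq0 negb_or => /andP[m_neq0 c_neq0].
have {}m0 : 0 < m by rewrite lt_neqAle eq_sym m_neq0.
have {}c0 : 0 < c by rewrite lt_neqAle eq_sym c_neq0.
rewrite ler_pM2l // -lnM ?posrE // ler_ln ?posrE //.
exact: lt_le_trans mcw.
Qed.

(** A mixture carries at most the mixed entropies plus the entropy of the choice
    between its components, weighted by their masses: in each coordinate the
    logarithm of the mixture dominates the logarithms of its two summands. *)
Lemma entropy_mixture (l s : R) y z : 0 <= l <= 1 ->
  (forall k, 0 <= y k 0) -> (forall k, 0 <= z k 0) ->
  \sum_k y k 0 = s -> \sum_k z k 0 = s ->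
  entropy ((1 - l) *: y + l *: z) <=
    (1 - l) * entropy y + l * entropy z - s * ((1 - l) * ln (1 - l) + l * ln l).
Proof.
move=> /andP[l0 l1] y0 z0 ys zs.
have l1' : 0 <= 1 - l by rewrite subr_ge0.
suff : (1 - l) * (\sum_k y k 0 * ln (y k 0)) + l * (\sum_k z k 0 * ln (z k 0)) +
    ((\sum_k y k 0) * ((1 - l) * ln (1 - l)) + (\sum_k z k 0) * (l * ln l)) <=
    \sum_k ((1 - l) *: y + l *: z) k 0 * ln (((1 - l) *: y + l *: z) k 0).
  by rewrite ys zs /entropy; lra.
rewrite !mulr_sumr !mulr_suml -!big_split /=; apply: ler_sum => k _; rewrite !mxE.
set w := (1 - l) * y k 0 + l * z k 0.
have hy := @xlnx_ge (1 - l) (y k 0) w l1' (y0 k) _.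
have hz := @xlnx_ge l (z k 0) w l0 (z0 k) _.
rewrite {1}/w [leRHS]mulrDl; apply: le_trans (lerD (hy _) (hz _)).
- by rewrite le_eqVlt; apply/orP; left; apply/eqP; ring.
- by rewrite lerDl mulr_ge0.
- by rewrite lerDr mulr_ge0.
Qed.

Lemma onem_ln_ge (l : R) : 0 <= l <= 1 -> - l <= (1 - l) * ln (1 - l).
Proof.
move=> /andP[l0]; rewrite le_eqVlt => /predU1P[->|l1].
  by rewrite subrr mul0r lerN10.
have l1' : 0 < 1 - l by rewrite subr_gt0.
have h : ln (1 - l)^-1 <= (1 - l)^-1 - 1.
  have v0 : 0 < (1 - l)^-1 by rewrite invr_gt0.
  have -> : ln (1 - l)^-1 = ln (1 + ((1 - l)^-1 - 1)) by rewrite [in RHS]addrC subrK.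
  by apply: le_ln1Dx; lra.
rewrite lnV ?posrE // in h.
have := ler_wpM2l (ltW l1') h; rewrite mulrBr mulfV ?gt_eqF // mulr1 mulrN; lra.
Qed.

(** Entropic penalisation in linear programming.  Trading the mass [l] spent
    on [z] for [y] improves the linear cost by [l * kappa], while the entropy
    term can change by at most [eps * l * (s + h - s * ln l)]; minimality makes
    the first no larger than the second, which bounds [ln l] from above. *)
Lemma entropic_mass_le (l s h eps kappa : R) d y z :
  0 < eps -> 0 < s -> 0 < l <= 1 ->
  (forall k, 0 <= y k 0) -> (forall k, 0 <= z k 0) ->
  \sum_k y k 0 = s -> \sum_k z k 0 = s ->
  let x := (1 - l) *: y + l *: z in
  dotv d x - eps * entropy x <= dotv d y - eps * entropy y ->
  entropy z - entropy y <= h -> kappa <= dotv d z - dotv d y ->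
  l <= expR ((s + h) / s - kappa / (eps * s)).
Proof.
move=> eps0 s0 /andP[l0 l1] y0 z0 ys zs x xmin hh hk.
have l01 : 0 <= l <= 1 by rewrite ltW.
have ent := entropy_mixture l01 y0 z0 ys zs; rewrite -/x in ent.
have onem := onem_ln_ge l01.
have dx : dotv d x = dotv d y + l * (dotv d z - dotv d y).
  by rewrite /x !dotvD; ring.
rewrite -[leLHS]lnK ?posrE // ler_expR.
have -> : (s + h) / s - kappa / (eps * s) = ((s + h) - kappa / eps) / s.
  by field; rewrite !gt_eqF.
rewrite ler_pdivlMr // -(ler_pM2l l0) -(ler_pM2l eps0).
have -> : eps * (l * (s + h - kappa / eps)) = eps * l * (s + h) - l * kappa.
  by field; rewrite gt_eqF.
have k1 : l * kappa <= l * (dotv d z - dotv d y) by rewrite ler_pM2l.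
have k2 : eps * entropy x <= eps * ((1 - l) * entropy y + l * entropy z
    - s * ((1 - l) * ln (1 - l) + l * ln l)) by rewrite ler_pM2l.
have k3 : eps * (l * (entropy z - entropy y)) <= eps * (l * h).
  by rewrite !ler_pM2l.
have k4 : eps * (s * - l) <= eps * (s * ((1 - l) * ln (1 - l))).
  by rewrite !ler_pM2l.
rewrite {}dx in xmin; move: xmin k1 k2 k3 k4.
move: (entropy x) (entropy y) (entropy z) (dotv d y) (dotv d z) (ln l) (ln (1 - l)).
move=> Hx Hy Hz a b L L1; lra.
Qed.

Context (s : R) (K : set 'cV[R]_n).
Hypothesis K_ge0 : forall x k, K x -> 0 <= x k 0.
Hypothesis massK : forall x, K x -> \sum_k x k 0 = s.

Lemma norm1_mass x : K x -> norm1 x = s.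
Proof.
by move=> Kx; rewrite -(massK Kx); apply: eq_bigr => k _; rewrite ger0_norm ?K_ge0.
Qed.

Lemma R_1_mass : K !=set0 -> R_1 K = s.
Proof.
move=> [x Kx]; rewrite /R_1 (_ : [set _ | _ in K] = [set s]) ?sup1 //.
apply/seteqP; split => [_ [y /norm1_mass <- <-]//|_ ->].
by exists x => //; exact: norm1_mass.
Qed.

Lemma coord_le_mass x k : K x -> x k 0 <= s.
Proof.
move=> Kx; rewrite -(massK Kx) (bigD1 k) //= lerDl.
by apply: sumr_ge0 => i _; exact: K_ge0.
Qed.

Lemma entropy_bounded x : K x -> - (s * s) <= entropy x <= n%:R.
Proof.
move=> Kx; rewrite /entropy lerN2; apply/andP; split.
  rewrite -{2}(massK Kx) mulr_sumr; apply: ler_sum => k _.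
  rewrite [leRHS]mulrC ler_wpM2l ?K_ge0 //.
  have := K_ge0 k Kx; rewrite le_eqVlt => /predU1P[<-|xk].
    by rewrite ln0 // -(massK Kx) sumr_ge0 // => i _; exact: K_ge0.
  by apply: le_trans (coord_le_mass k Kx); apply/ltW/ln_sublinear.
rewrite -sumrN -[n in leRHS]card_ord -sum1_card natr_sum; apply: ler_sum => k _.
have := K_ge0 k Kx; rewrite le_eqVlt => /predU1P[<-|xk]; first by rewrite mul0r oppr0 ler01.
rewrite -mulrN -lnV ?posrE //.
apply: le_trans (_ : x k 0 * (x k 0)^-1 <= _); last by rewrite mulfV // gt_eqF.
by rewrite ler_pM2l //; apply/ltW/ln_sublinear; rewrite invr_gt0.
Qed.

Lemma le_R_H x y : K x -> K y -> entropy x - entropy y <= R_H K.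
Proof.
move=> Kx Ky; apply: ub_le_sup; last by exists x, y.
exists (n%:R + s * s) => _ [x' [y' [Kx' Ky' ->]]].
have /andP[_ ?] := entropy_bounded Kx'; have /andP[? _] := entropy_bounded Ky'.
lra.
Qed.

Lemma R_H_ge0 : K !=set0 -> 0 <= R_H K.
Proof. by move=> [x Kx]; rewrite -(subrr (entropy x)) le_R_H. Qed.

End Entropy.

(** * Segments and boundaries *)

(** The supremum of the times that the segment spends in [C] gives a point of the
    closure; it is not interior, or the segment would stay in [C] a little longer. *)
Lemma segment_meets_bd (R : realType) (r : nat) (C : set 'cV[R]_r) u0 u :
  C u0 -> ~ C u -> exists2 t, 0 <= t <= 1 & bd C (u0 + t *: (u - u0)).
Proof.
move=> Cu0 nCu; pose phi (t : R) : 'cV[R]_r := u0 + t *: (u - u0).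
have phi_cts : continuous phi.
  move=> t; apply: cvgD; first exact: cvg_cst.
  by apply: cvgZr_tmp; exact: cvg_id.
pose S := [set t | 0 <= t <= 1 /\ C (phi t)].
have S0 : S 0 by rewrite /S /= lexx ler01 /phi scale0r addr0.
have supS : has_sup S by split; [exists 0|exists 1 => t [/andP[_ ?] _]].
have sup_ge0 : 0 <= sup S by exact: ub_le_sup supS.2 _ S0.
have sup_le1 : sup S <= 1 by apply: ge_sup => [|t [/andP[_ ?] _]]; first exists 0.
exists (sup S); first by rewrite sup_ge0.
split => [B /phi_cts /nbhs_ballP[e /= e0 eB]|].
  have [t St tS] := sup_adherent e0 supS.
  exists (phi t); split; first exact: St.2.
  apply: eB; rewrite /ball /= ger0_norm; first by lra.
  by rewrite subr_ge0; exact: ub_le_sup supS.2 _ St.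
move=> Cint; have := phi_cts (sup S) _ Cint => /nbhs_ballP[e /= e0 eC].
have sup_lt1 : sup S < 1.
  rewrite lt_neqAle sup_le1 andbT; apply/eqP => S1; apply: nCu.
  by have := interior_subset Cint; rewrite S1 scale1r addrC subrK.
pose m := Num.min e (1 - sup S).
have m0 : 0 < m by rewrite lt_min e0 subr_gt0.
have [me m1] : m <= e /\ m <= 1 - sup S by rewrite /m !ge_min !lexx orbT.
have : S (sup S + m / 2).
  split; first by apply/andP; split; lra.
  apply: eC; rewrite /ball /= opprD addNKr normrN ger0_norm; lra.
move=> /(ub_le_sup supS.2); lra.
Qed.

(** * Concave quadratic programmes and their dual *)

Section ConcaveQuadratic.
Context (R : realType) (n r nV : nat) (K : set 'cV[R]_n).
Context (c : 'cV[R]_n) (B : 'M[R]_(r, n)) (v : 'I_nV -> 'cV[R]_n).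
Implicit Types (x y z : 'cV[R]_n) (u : 'cV[R]_r).

Definition concave_obj x := dotv c x - 2^-1 * enorm (B *m x) ^+ 2.

Definition slope u := c - B^T *m u.

(** The concave term replaced by its tangent at [u].  Minimising over [u] gives back
    [concave_obj], minimising over [x] in [K] gives [g_0]. *)
Definition joint_obj u x := 2^-1 * enorm u ^+ 2 + dotv (slope u) x.

Lemma joint_objE u x : joint_obj u x = concave_obj x + 2^-1 * enorm (u - B *m x) ^+ 2.
Proof.
rewrite /joint_obj /concave_obj /slope !sqr_enorm !dotvD dotv_trmx (dotvC (B *m x) u).
by field.
Qed.

Lemma joint_obj_diag x : joint_obj (B *m x) x = concave_obj x.
Proof. by rewrite joint_objE subrr enorm0 expr0n mulr0 addr0. Qed.

Lemma concave_obj_le u x : concave_obj x <= joint_obj u x.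
Proof. by rewrite joint_objE lerDl mulr_ge0 ?invr_ge0 // sqr_ge0. Qed.

Hypothesis hullK : forall x, K x <-> hull v predT x.

Lemma vertexK i : K (v i).
Proof. exact/hullK/hull_point. Qed.

Lemma coneP i u :
  cone c B v i u <-> forall x, K x -> dotv (slope u) (v i) <= dotv (slope u) x.
Proof.
split=> [h x /hullK|h j _]; last exact/h/vertexK.
apply: hull_dotv_ge => j _; have [->//|ji] := eqVneq j i; exact: h.
Qed.

Lemma g_0_cone i u : cone c B v i u -> g_0 K c B u = joint_obj u (v i).
Proof.
move=> /coneP h; congr (_ + _); apply/le_anti/andP; split.
  apply: ge_inf; last by exists (v i); [exact: vertexK|].
  by exists (dotv (slope u) (v i)) => _ [x /h ? <-].
apply: lb_le_inf; first by exists (dotv (slope u) (v i)), (v i); first exact: vertexK.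
by move=> _ [x /h ? <-].
Qed.

Hypothesis K0 : K !=set0.

(** The linear programme at [u] attains its minimum at a vertex. *)
Lemma cone_cover u : exists i, cone c B v i u.
Proof.
have [x /hullK[w [_ w1 _ _]]] := K0.
case: nV v w w1 hullK => [v' w|m v' w _ h].
  by rewrite big_ord0 => /eqP; rewrite eq_sym oner_eq0.
have [i hi] := argmin_vertex v' (slope u) ord0.
by exists i => j _; apply: hi; apply: hull_point.
Qed.

Lemma g_0_le u x : K x -> g_0 K c B u <= joint_obj u x.
Proof.
move=> Kx; have [i ci] := cone_cover u.
by rewrite (g_0_cone ci) lerD2l; apply: (coneP i u).1.
Qed.

(** On every cone [g_0] is the joint objective at a vertex, hence bounded below by
    the smallest value of [concave_obj] at a vertex. *)
Lemma dual_attained :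
  exists i, forall u, concave_obj (v i) <= g_0 K c B u.
Proof.
have [i0 _] := cone_cover 0.
have [i _ h] := Order.TotalTheory.arg_minP (fun i => concave_obj (v i))
  (isT : predT i0).
exists i => u; have [j cj] := cone_cover u; rewrite (g_0_cone cj).
exact: le_trans (h j isT) (concave_obj_le _ _).
Qed.

Lemma g_0_diag_le x : K x -> g_0 K c B (B *m x) <= concave_obj x.
Proof. by move=> Kx; rewrite -joint_obj_diag g_0_le. Qed.

(** Any value of [concave_obj] on [K] bounds from above a value of [g_0], by
    [g_0_diag_le]; so the two minima coincide. *)
Lemma dual_min_primal i : (forall u, concave_obj (v i) <= g_0 K c B u) ->
  argmin K concave_obj (v i).
Proof.
move=> h; split=> [|x Kx]; first exact: vertexK.
exact: le_trans (h _) (g_0_diag_le Kx).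
Qed.

(** On the cone of [i], [g_0] is [concave_obj (v i)] plus half the squared distance
    to [B *m v i], while its value at [B *m v i] is at most [concave_obj (v i)]; a
    global minimiser in the cone can therefore only be [B *m v i] itself. *)
Lemma IstarP i : Istar K c B v i ->
  cone c B v i (B *m v i) /\ forall u, concave_obj (v i) <= g_0 K c B u.
Proof.
move=> [u [ci [_ umin]]].
have gu := g_0_cone ci; rewrite joint_objE in gu.
have ule := le_trans (umin (B *m v i) I) (g_0_diag_le (vertexK i)).
have sq0 : enorm (u - B *m v i) ^+ 2 <= 0.
  by move: ule; rewrite gu gerDl pmulr_rle0 // invr_gt0.
have uE : u = B *m v i.
  apply/eqP; rewrite -subr_eq0; apply/eqP/enorm_eq0/eqP.
  by rewrite -sqrf_eq0; apply/eqP/le_anti; rewrite sq0 sqr_ge0.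
split=> [|u']; first by rewrite -uE.
apply: le_trans (umin u' I); rewrite gu lerDl mulr_ge0 ?invr_ge0 //.
exact: sqr_ge0.
Qed.

(** A cone that contains a point contains every ball around it that does not reach
    the boundary. *)
Lemma ball_sub_cone i u : cone c B v i (B *m v i) ->
  ((enorm (u - B *m v i))%:E < gamma_ c B v i)%E -> cone c B v i u.
Proof.
move=> ci; apply: contraPP => nci.
have [t /andP[t0 t1] bdt] := segment_meets_bd ci nci.
apply/negP; rewrite -leNgt.
apply: le_trans (_ : (enorm (B *m v i - (B *m v i + t *: (u - B *m v i))))%:E <= _)%E.
  by apply: ereal_inf_lbound; eexists; first exact: bdt.
rewrite lee_fin opprD addNKr enormN enormZ ger0_norm // ler_piMl //.
exact: enorm_ge0.
Qed.

(** At distance less than [g / 2] from the centre of a ball of radius [g] inside the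
    cone, one may still move [u] by [g / 2] in the direction that favours vertex [k]
    most, and vertex [i] stays optimal; hence it was better than [k] by the amount
    that this move costs. *)
Lemma gap_in_ball i k u (g : R) :
  (forall u', enorm (u' - B *m v i) < g -> cone c B v i u') ->
  2 * enorm (u - B *m v i) < g ->
  g / 2 * enorm (B *m v k - B *m v i) <=
    dotv (slope u) (v k) - dotv (slope u) (v i).
Proof.
move=> ball ug; pose w := B *m v k - B *m v i.
have u0 := enorm_ge0 (u - B *m v i).
pose a := g / 2 / enorm w.
have au : cone c B v i (u + a *: w).
  apply: ball; rewrite addrAC; apply: le_lt_trans (enormD _ _) _.
  have : enorm (a *: w) <= g / 2; last lra.
  rewrite enormZ ger0_norm ?divr_ge0 ?enorm_ge0 //; last lra.
  have [->|w0] := eqVneq (enorm w) 0; first by rewrite mulr0; lra.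
  by rewrite /a divfK.
have := (coneP i _).1 au (v k) (vertexK k); rewrite -subr_ge0 -!dotvBr.
have -> : slope (u + a *: w) = slope u - B^T *m (a *: w).
  by rewrite /slope mulmxDr opprD addrA.
rewrite dotvBl [X in _ - X]dotv_trmx mulmxBr -/w dotvZl -sqr_enorm subr_ge0.
congr (_ <= _).
have [->|w0] := eqVneq (enorm w) 0; first by rewrite expr0n !mulr0.
by rewrite /a; field.
Qed.

Section NearVertex.
Context (i : 'I_nV).
Hypothesis ci : cone c B v i (B *m v i).

(** When the cone of [i] contains a ball around [B *m v i], these vertices have the
    image and the linear cost of [v i] ([tied_image]), and they stay optimal
    everywhere in the cone. *)
Definition tied : pred 'I_nV :=
  [pred k | `[< lp_argmin K (slope (B *m v i)) (v k) >]].

Lemma gap_gamma k u g : (g%:E <= gamma_ c B v i)%E ->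
  2 * enorm (u - B *m v i) < g ->
  g / 2 * enorm (B *m v k - B *m v i) <=
    dotv (slope u) (v k) - dotv (slope u) (v i).
Proof.
move=> gg; apply: gap_in_ball => u' u'g; apply: ball_sub_cone => //.
by apply: lt_le_trans gg; rewrite lte_fin.
Qed.

Lemma tied_self : tied i.
Proof. by apply/asboolP; split; [exact: vertexK|exact/coneP]. Qed.

Lemma tiedP k : tied k ->
  dotv (slope (B *m v i)) (v k) = dotv (slope (B *m v i)) (v i).
Proof.
move=> /asboolP[_ kmin]; have /asboolP[_ imin] := tied_self.
by apply/le_anti; rewrite kmin ?imin //; exact: vertexK.
Qed.

Hypothesis gamma_gt0 : (0 < gamma_ c B v i)%E.

(** A tied vertex with a different image under [B] would become strictly better
    than [v i] at some point near [B *m v i], inside the cone of [i]. *)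
Lemma tied_image k : tied k -> B *m v k = B *m v i /\ dotv c (v k) = dotv c (v i).
Proof.
move=> tk; have tE := tiedP tk.
have [g g0 gg] : exists2 g : R, 0 < g & (g%:E <= gamma_ c B v i)%E.
  move: gamma_gt0; case: (gamma_ c B v i) => [g|_|//]; last by exists 1; rewrite ?leey.
  by rewrite lte_fin => g0; exists g.
have := gap_gamma k (u := B *m v i) gg; rewrite subrr enorm0 mulr0 tE subrr.
move=> /(_ g0); rewrite pmulr_rle0 ?divr_gt0 // => h.
have BE : B *m v k = B *m v i.
  apply/eqP; rewrite -subr_eq0; apply/eqP/enorm_eq0/le_anti.
  by rewrite h enorm_ge0.
by split=> //; move: tE; rewrite /slope !dotvBl !dotv_trmx BE => /addIr.
Qed.

Lemma hull_tied y : hull v tied y ->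
  B *m y = B *m v i /\ dotv c y = dotv c (v i).
Proof.
move=> hy; split; last by apply: hull_dotv hy => k /tied_image[].
by apply: hull_mulmx hy => k /tied_image[].
Qed.

Lemma slope_tied u y : hull v tied y -> dotv (slope u) y = dotv (slope u) (v i).
Proof.
by move=> /hull_tied[By cy]; rewrite /slope !dotvBl !dotv_trmx By cy.
Qed.

Lemma argmin_tied y : (forall u, concave_obj (v i) <= g_0 K c B u) ->
  hull v tied y -> argmin K concave_obj y.
Proof.
move=> /dual_min_primal[_ imin] hy; have [By cy] := hull_tied hy.
split=> [|x /imin]; first by apply/hullK; apply: hull_sub hy.
by rewrite /concave_obj By cy.
Qed.

Lemma untied_weight z : hull v (predC tied) z -> exists k, ~~ tied k.
Proof.
move=> [w [_ w1 w_tied _]]; apply: contrapT => nex.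
move: w1; rewrite big1 => [/eqP|k _]; first by rewrite eq_sym oner_eq0.
by apply: w_tied; apply/negP => ntk; apply: nex; exists k.
Qed.

Hypothesis vertK : forall k, vertices K (v k).

Lemma lp_gap_le k : ~~ tied k ->
  (lp_gap K (slope (B *m v i)) <=
   (dotv (slope (B *m v i)) (v k) - dotv (slope (B *m v i)) (v i))%:E)%E.
Proof.
move=> ntk; rewrite EFinB; apply: leeB.
  apply: ereal_inf_lbound; exists (v k) => //; split; first exact: vertK.
  by move=> ok; move/negP: ntk; apply; apply/asboolP.
apply: le_ereal_inf_tmp => _ [x [Kx _] <-]; rewrite lee_fin.
exact: (coneP i _).1.
Qed.

(** At a point [u] close to [B *m v i], an untied vertex loses to [v i] by at least
    [Delta_ i].  If it has the same image under [B] its cost difference does not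
    depend on [u], and the gap of the linear programme at [B *m v i] applies;
    otherwise the room left in the cone does. *)
Lemma Delta_le k u : ((2 * enorm (u - B *m v i))%:E < gamma_ c B v i)%E ->
  ~~ tied k ->
  (Delta_ K c B v i <= (dotv (slope u) (v k) - dotv (slope u) (v i))%:E)%E.
Proof.
move=> ug ntk; rewrite /Delta_ ge_min; apply/orP.
have [BE|BE] := pselect (B *m v k = B *m v i).
  left; apply: le_trans (lp_gap_le ntk) _.
  by rewrite lee_fin /slope !dotvBl !dotv_trmx BE; lra.
right; set D := _ - dotv _ _; set w := B *m v k - B *m v i.
have w0 : 0 < enorm w.
  rewrite lt_neqAle enorm_ge0 andbT; apply/eqP => /esym/enorm_eq0/eqP.
  by rewrite subr_eq0 => /eqP.
have inf_le : (ereal_inf [set (enorm (B *m v l - B *m v i))%:E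
    | l in [set l | B *m v l <> B *m v i]] <= (enorm w)%:E)%E.
  by apply: ereal_inf_lbound; exists k.
have gap := @gap_gamma k u.
case: (gamma_ c B v i) ug gap gamma_gt0 => [g|_ gap _|//].
  rewrite !lte_fin => ug gap g0.
  apply: le_trans (lee_wpmul2l _ inf_le) _; first by rewrite lee_fin mulr_ge0 ?ltW.
  by rewrite -!EFinM lee_fin; apply: gap.
(* In an infinite ball the bound of gap_in_ball would hold for every radius. *)
pose g := Num.max (2 * enorm (u - B *m v i) + 1) (2 * (D + 1) / enorm w).
have gu : 2 * enorm (u - B *m v i) < g by rewrite lt_max ltrDl ltr01.
have := gap g (leey _) gu; rewrite -/D -/w leNgt => /negP; case.
have : 2 * (D + 1) / enorm w <= g by rewrite le_max lexx orbT.
rewrite ler_pdivrMr //; move: (g) (D) (enorm w) => g1 D1 e1; lra.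
Qed.

End NearVertex.

Hypothesis vertK : forall k, vertices K (v k).

(** A cone without minimisers of [g_0] only has values of [g_0] at least [alpha] above
    the minimum. *)
Lemma alpha_Istar i u (h : R) :
  cone c B v i u -> (h%:E < alpha K c B v)%E ->
  (forall j, (forall u', concave_obj (v j) <= g_0 K c B u') ->
    g_0 K c B u <= concave_obj (v j) + h) ->
  Istar K c B v i.
Proof.
move=> ci ha near_opt; apply: contrapT => nIi.
move: ha; apply/negP; rewrite -leNgt.
have [j jmin] := dual_attained.
rewrite -[h](addrK (concave_obj (v j))) EFinB; apply: leeB.
  apply: (@le_trans _ _ (g_0 K c B u)%:E); last by rewrite lee_fin addrC near_opt.
  by apply: ereal_inf_lbound; exists u => //; exists i.
by apply: le_ereal_inf_tmp => _ [u' _ <-]; rewrite lee_fin.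
Qed.

Lemma gamma_ge0 : (0 <= gamma K c B v)%E.
Proof.
apply: le_ereal_inf_tmp => _ [i _ <-]; apply: le_ereal_inf_tmp => _ [x _ <-].
by rewrite lee_fin enorm_ge0.
Qed.

(** The factor 8 makes half a squared distance below [gamma ^+ 2 / 8] a distance
    below [gamma / 2], which is what [Delta_le] asks for. *)
Lemma gamma_dist i u (h : R) : Istar K c B v i ->
  ((8 * h)%:E < gamma K c B v ^+ 2)%E -> 2^-1 * enorm (u - B *m v i) ^+ 2 <= h ->
  ((2 * enorm (u - B *m v i))%:E < gamma_ c B v i)%E.
Proof.
move=> Ii hg uh; have gi : (gamma K c B v <= gamma_ c B v i)%E.
  by apply: ereal_inf_lbound; exists i.
apply: lt_le_trans gi; rewrite ltNge; apply/negP => gu.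
have := gamma_ge0; move: hg gu; case: (gamma K c B v) => [g|//|//].
rewrite -EFin_expe !lte_fin !lee_fin => hg gu g0.
have : g ^+ 2 <= (2 * enorm (u - B *m v i)) ^+ 2 by rewrite ler_sqr ?nnegrE // mulr_ge0 ?enorm_ge0.
by rewrite exprMn; lra.
Qed.

End ConcaveQuadratic.

(** * Exponential convergence *)

Section ConvergenceRate.
Context (R : realType) (n r nV : nat) (K : set 'cV[R]_n).
Context (c : 'cV[R]_n) (B : 'M[R]_(r, n)) (v : 'I_nV -> 'cV[R]_n) (s : R).
Implicit Types (x y z : 'cV[R]_n).
Hypothesis s_gt0 : 0 < s.
Hypothesis K_ge0 : forall x k, K x -> 0 <= x k 0.
Hypothesis massK : forall x, K x -> \sum_k x k 0 = s.
Hypothesis hullK : forall x, K x <-> hull v predT x.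
Hypothesis vertK : forall k, vertices K (v k).

Notation F := (concave_obj c B).

(** The penalised minimiser [x] splits into a mixture of optimal vertices [y], which
    minimises [F], and a remainder [z] of weight [l].  With [u = B *m x], near
    optimality of [u] for [g_0] finds a vertex [v i] whose cone contains [u] at
    controlled depth, and [y] collects the vertices tied with [v i]. *)
Lemma entropic_face_decomposition (eps : R) x :
  0 < eps -> (eps%:E < eps_bar K c B v)%E ->
  argmin K (fun y => F y - eps * entropy y) x ->
  exists l y z, [/\ 0 <= l <= 1, x = (1 - l) *: y + l *: z, argmin K F y, K z &
    l != 0 -> exists2 delta, Delta K c B v = delta%:E &
      eps * (s + R_H K) < delta /\
      l <= expR ((s + R_H K) / s - delta / (eps * s))].
Proof.
move=> eps0 epsbar [Kx xmin].
have K0 : K !=set0 by exists x.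
have Hge0 := R_H_ge0 K_ge0 massK K0.
move: epsbar; rewrite /eps_bar !lt_min (R_1_mass K_ge0 massK K0) => /and3P[ea eg ed].
(* If [R_H] were zero, so would be its inverse and the bound on [eps]. *)
have H0 : 0 < R_H K.
  rewrite lt_neqAle Hge0 andbT; apply/eqP => H0; move: ea.
  by rewrite -H0 invr0 mule0 lte_fin ltNge ltW.
rewrite lte_pdivlMr ?addr_gt0 // -EFinM in ed.
rewrite lte_pdivlMr // -EFinM in ea.
rewrite lte_pdivlMr ?mulr_gt0 // -EFinM mulrCA in eg.
pose u := B *m x.
have near_opt j : g_0 K c B u <= F (v j) + eps * R_H K.
  have Kj := vertexK hullK j.
  have h1 := g_0_diag_le c B hullK K0 Kx; have h2 := xmin _ Kj.
  have h3 : eps * (entropy x - entropy (v j)) <= eps * R_H K.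
    by rewrite ler_pM2l // (le_R_H K_ge0 massK).
  by move: h1 h2 h3; rewrite -/u; lra.
have [i ci] := cone_cover c B hullK K0 u.
have Ii : Istar K c B v i.
  by apply: (alpha_Istar hullK K0 ci ea) => j _; exact: near_opt.
have [ci0 imin] := IstarP hullK K0 Ii.
have ug : ((2 * enorm (u - B *m v i))%:E < gamma_ c B v i)%E.
  apply: (gamma_dist Ii eg); have := near_opt i.
  by rewrite (g_0_cone hullK ci) joint_objE lerD2l.
have gamma_gt0 : (0 < gamma_ c B v i)%E.
  by apply: le_lt_trans ug; rewrite lee_fin mulr_ge0 ?enorm_ge0.
have [l [y [z [l01 xE hy hz hz']]]] :=
  hull_split (tied_self hullK ci0) ((hullK x).1 Kx).
have Ky : K y by apply/hullK; apply: hull_sub hy.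
have Kz : K z by exact/hullK.
exists l, y, z; split => //; first exact: (argmin_tied hullK K0 ci0 gamma_gt0 imin hy).
move=> l_neq0; have {hz'}hz' := hz' l_neq0.
have Delta_lt k : ~~ tied K c B v i k ->
    (Delta K c B v <= (dotv (slope c B u) (v k) - dotv (slope c B u) (v i))%:E)%E.
  move=> ntk; apply: le_trans (Delta_le hullK ci0 gamma_gt0 vertK ug ntk).
  by apply: ereal_inf_lbound; exists i.
have [k0 ntk0] := untied_weight hz'.
have := Delta_lt _ ntk0; move: ed Delta_lt.
case: (Delta K c B v) => [delta|//|//]; rewrite lte_fin => ed Delta_lt _.
exists delta => //; split => //.
have l_gt0 : 0 < l <= 1.
  by move/andP: l01 => [l0 ->]; rewrite lt_neqAle eq_sym l_neq0 l0.
apply: (@entropic_mass_le _ _ l s (R_H K) eps delta (slope c B u) y z) => //.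
- by move=> k; apply: K_ge0.
- by move=> k; apply: K_ge0.
- exact: massK.
- exact: massK.
(* The joint objective at [u] is [F] at [x] and at least [F] at [y]. *)
- rewrite -xE; have h1 := xmin _ Ky; have h2 := concave_obj_le c B u y.
  by have := joint_obj_diag c B x; rewrite -/u; move: h1 h2; rewrite /joint_obj; lra.
- exact: (le_R_H K_ge0 massK).
rewrite (slope_tied hullK ci0 gamma_gt0 u hy) lerBrDr.
by apply: (hull_dotv_ge _ hz') => k /Delta_lt; rewrite lee_fin lerBrDr.
Qed.

Lemma enorm_mass x : K x -> enorm x <= s.
Proof. by move=> Kx; rewrite -(norm1_mass K_ge0 massK Kx) enorm_le_norm1. Qed.

Lemma dist_mixture_le l y z A : 0 <= l -> K y -> K z -> A y ->
  (dist ((1 - l) *: y + l *: z) A <= (l * (2 * s))%:E)%E.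
Proof.
move=> l0 Ky Kz Ay.
apply: le_trans (_ : (enorm ((1 - l) *: y + l *: z - y))%:E <= _)%E.
  by apply: ereal_inf_lbound; exists y.
have -> : (1 - l) *: y + l *: z - y = l *: (z - y).
  by apply/matrixP => i j; rewrite !mxE; ring.
rewrite lee_fin enormZ ger0_norm // ler_wpM2l //.
have := enormB z y; have := enorm_mass Ky; have := enorm_mass Kz; lra.
Qed.

Lemma concave_objB x y : F x - F y =
  dotv c (x - y) - 2^-1 * dotv (x - y) ((B^T *m B) *m (x + y)).
Proof.
rewrite /concave_obj !sqr_enorm -mulmxA (dotvC (x - y)) dotv_trmx.
by rewrite !mulmxDr mulmxN !dotvD (dotvC (B *m y) (B *m x)); field.
Qed.

Lemma concave_obj_mixture_le l y z : 0 <= l <= 1 -> K y -> K z ->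
  F ((1 - l) *: y + l *: z) - F y <=
    l * (2 * enorm c * s + 2 * s ^+ 2 * opnorm (B^T *m B)).
Proof.
move=> /andP[l0 l1] Ky Kz; set x := (1 - l) *: y + l *: z.
have Kx : K x.
  rewrite /x -[in l *: z](subKr 1 l); apply/hullK/hull_convex; try exact/hullK.
  by rewrite subr_ge0 l1 gerBl.
have [[ny nz] nx] := (enorm_mass Ky, enorm_mass Kz, enorm_mass Kx).
have xy : x - y = l *: (z - y).
  by apply/matrixP => i j; rewrite !mxE; ring.
have nzy : enorm (x - y) <= l * (2 * s).
  rewrite xy enormZ ger0_norm // ler_wpM2l //.
  have := enormB z y; lra.
have nxy : enorm (x + y) <= 2 * s by have := enormD x y; lra.
rewrite concave_objB.
have h1 : dotv c (x - y) <= enorm c * (l * (2 * s)).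
  apply: le_trans (ler_norm _) _; apply: le_trans (cauchy_schwarz _ _) _.
  by rewrite ler_wpM2l ?enorm_ge0.
have h2 : - dotv (x - y) ((B^T *m B) *m (x + y)) <=
    (l * (2 * s)) * (opnorm (B^T *m B) * (2 * s)).
  apply: le_trans (ler_norm _) _; rewrite normrN.
  apply: le_trans (cauchy_schwarz _ _) _; apply: ler_pM => //; try exact: enorm_ge0.
  apply: le_trans (enorm_mulmx _ _) _; apply: ler_wpM2l => //.
  exact: opnorm_ge0.
move: h1 h2; lra.
Qed.


(** In terms of the exponent [t] of the announced rate, the mass outside the face
    decays like [expR (- t) ^+ 2], and [t >= 1 / 2] makes one of the two factors
    at most [2 / 3]. *)
Lemma mass_decay (eps l delta : R) : 0 < eps -> 0 <= R_H K ->
  eps * (s + R_H K) < delta ->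
  l <= expR ((s + R_H K) / s - delta / (eps * s)) ->
  let t := delta * (2 * s)^-1 * eps^-1 in
  3 / 2 * expR (- t) <= 1 /\ l <= expR ((s + R_H K) / s) * (expR (- t) * expR (- t)).
Proof.
move=> eps0 H0 ed ll t; split.
  have t_ge : 2^-1 <= t.
    rewrite /t -mulrA -invfM ler_pdivlMr ?mulr_gt0 //.
    have : 0 <= eps * R_H K by rewrite mulr_ge0 // ltW.
    by move: ed; lra.
  rewrite expRN ler_pdivrMr ?expR_gt0 // mul1r.
  by apply: le_trans (expR_ge1Dx t); lra.
apply: (le_trans ll); rewrite -!expRD ler_expR le_eqVlt; apply/orP; left.
by apply/eqP; rewrite /t; field; rewrite !gt_eqF.
Qed.

Section Rate.
Context (eps : R) (x : 'cV[R]_n).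
Hypothesis eps_gt0 : 0 < eps.
Hypothesis eps_lt : (eps%:E < eps_bar K c B v)%E.
Hypothesis x_opt : argmin K (fun y => F y - eps * entropy y) x.

Let Kx : K x. Proof. by case: x_opt. Qed.
Let K0 : K !=set0. Proof. by exists x. Qed.
Let R1E : R_1 K = s. Proof. exact: R_1_mass K_ge0 massK K0. Qed.
Let H_ge0 : 0 <= R_H K. Proof. exact: R_H_ge0 K_ge0 massK K0. Qed.

Notation rate := (expeR (- (C_2 K c B v * (eps^-1)%:E))).

Lemma dist_rate : (dist x (argmin K F) <= (C_1 K)%:E * rate)%E.
Proof.
have [l [y [z [/andP[l0 l1] -> ymin Kz hl]]]] :=
  entropic_face_decomposition eps_gt0 eps_lt x_opt.
apply: le_trans (dist_mixture_le l0 _ Kz ymin) _; first by case: ymin.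
rewrite /C_1 /C_2 R1E.
have [->|/hl[delta -> [ed ll]]] := eqVneq l 0.
  by rewrite mul0r mule_ge0 ?expeR_ge0 // lee_fin !mulr_ge0 ?expR_ge0 // ltW.
have [h1 h2] := mass_decay eps_gt0 H_ge0 ed ll.
rewrite -!EFinM /= lee_fin; move: h1 h2 => /=.
set E := expR (_ / s); set e := expR (- _) => h1 h2.
have e0 : 0 <= e := expR_ge0 _; have E0 : 0 <= E := expR_ge0 _.
rewrite [leLHS]mulrC -[leRHS]mulrA ler_wpM2l ?mulr_ge0 ?(ltW s_gt0) //; apply: (le_trans h2).
by rewrite mulrA ler_piMr ?mulr_ge0 //; lra.
Qed.

(** Both parts of the estimate of [F x - F y] count: with [a] and [b] the two
    arguments of the maximum it is [l * (b + a / 2)], up to [3 / 2] times the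
    maximum, which the factor [2 / 3] of [mass_decay] compensates. *)
Lemma cost_rate : exists2 y, argmin K F y &
  ((F x - F y)%:E <= (C_1' K c (B^T *m B))%:E * rate)%E.
Proof.
have [l [y [z [l01 -> ymin Kz hl]]]] :=
  entropic_face_decomposition eps_gt0 eps_lt x_opt.
exists y => //; have [Ky _] := ymin.
have := concave_obj_mixture_le l01 Ky Kz; rewrite -lee_fin => /le_trans; apply.
rewrite /C_1' /C_2 R1E.
set a := 4 * s ^+ 2 * _; set b := 2 * enorm c * s; set m := Num.max a b.
have a0 : 0 <= a by rewrite mulr_ge0 ?opnorm_ge0 // mulr_ge0 // sqr_ge0.
have b0 : 0 <= b by rewrite !mulr_ge0 ?enorm_ge0 // ltW.
have [am bm] : a <= m /\ b <= m by rewrite /m !le_max !lexx orbT.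
have m0 : 0 <= m := le_trans a0 am.
have [->|/hl[delta -> [ed ll]]] := eqVneq l 0.
  by rewrite mul0r mule_ge0 ?expeR_ge0 // lee_fin mulr_ge0 // expR_ge0.
have [h1 h2] := mass_decay eps_gt0 H_ge0 ed ll.
rewrite -!EFinM /= lee_fin; move: h1 h2 => /=.
set E := expR (_ / s); set e := expR (- _) => h1 h2.
have e0 : 0 <= e := expR_ge0 _; have E0 : 0 <= E := expR_ge0 _.
have abm : b + 2 * s ^+ 2 * opnorm (B^T *m B) <= 3 / 2 * m.
  have -> : 2 * s ^+ 2 * opnorm (B^T *m B) = a / 2 by rewrite /a; field.
  lra.
have l0 : 0 <= l by case/andP: l01.
apply: le_trans (ler_wpM2l l0 abm) _.
have m32 : 0 <= 3 / 2 * m by lra.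
apply: le_trans (ler_wpM2r m32 h2) _.
have -> : E * (e * e) * (3 / 2 * m) = m * E * e * (3 / 2 * e) by field.
by rewrite ler_piMr // !mulr_ge0.
Qed.

End Rate.
End ConvergenceRate.

(** * Measures carried by finitely many points *)

Section AtomicMeasure.
Import HBNNSimple.
Context (R : realType) (d : measure_display) (T : measurableType d) (n : nat).
Implicit Types (p : 'I_n -> T).

(** The family of [msum] is indexed by all natural numbers; [insub] extends it by
    zero from [n] on. *)
Definition atomic (w : 'I_n -> {nonneg R}) p : {measure set T -> \bar R} :=
  msum (fun k => if insub k is Some i then mscale (w i) (dirac (p i))
                 else mzero) n.

Lemma atomicE w p A : atomic w p A = (\sum_k (w k)%:num%:E * \d_(p k) A)%E.
Proof. by rewrite /atomic /= /msum; apply: eq_bigr => k _; rewrite valK. Qed.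

Lemma ge0_integral_atomic w p (f : T -> \bar R) :
  (forall t, 0 <= f t)%E -> measurable_fun setT f ->
  (\int[atomic w p]_t f t = \sum_k (w k)%:num%:E * f (p k))%E.
Proof.
move=> f0 mf; rewrite ge0_integral_measure_sum //; apply: eq_bigr => k _.
rewrite valK ge0_integral_mscale // integral_dirac //.
by rewrite diracT mul1e.
Qed.

Lemma atomic_probability (x : 'I_n -> R) p :
  (forall k, 0 <= x k) -> \sum_k x k = 1 ->
  exists P : probability T R, forall A, P A = (\sum_k (x k)%:E * \d_(p k) A)%E.
Proof.
move=> x0 x1; pose mu := atomic (fun k => NngNum (x0 k)) p.
have mu1 : mu setT = 1%E.
  rewrite /mu atomicE -[1%E]/(1%:E) -x1 -sumEFin; apply: eq_bigr => k _.
  by rewrite diracT mule1.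
exists (mnormalize mu (dirac point)) => A.
transitivity (mu A); last by rewrite /mu atomicE.
by rewrite /= /mnormalize mu1 onee_eq0 /= invr1 mule1.
Qed.

Definition atoms (mu : probability T R) p :=
  [/\ injective p, forall k, measurable [set p k] & mu (range p) = 1%E].

Lemma range_bigsetU p : range p = \big[setU/set0]_(k < n) [set p k].
Proof.
apply/seteqP; split => [_ [k _ <-]|t]; first by rewrite (bigD1 k) //=; left.
by elim/big_ind: _ => [[]|A B hA hB [/hA|/hB]|k _ ->] //; exists k.
Qed.

Context (mu : probability T R) (p : 'I_n -> T).
Hypothesis mu_atoms : atoms mu p.

Definition weight k : R := fine (mu [set p k]).

Lemma weightE k : mu [set p k] = (weight k)%:E.
Proof. by rewrite fineK // fin_num_measure //; case: mu_atoms. Qed.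

Lemma weight_ge0 k : 0 <= weight k.
Proof. by rewrite fine_ge0. Qed.

Lemma measurable_range : measurable (range p).
Proof.
by rewrite range_bigsetU; apply: bigsetU_measurable => k _; case: mu_atoms.
Qed.

Lemma atoms_setC : mu (~` range p) = 0%E.
Proof.
rewrite probability_setC; last exact: measurable_range.
by case: mu_atoms => _ _ ->; rewrite subee.
Qed.

Lemma measure_atoms A : measurable A ->
  mu A = (\sum_k (weight k)%:E * \d_(p k) A)%E.
Proof.
move=> mA; have [pinj mp mu1] := mu_atoms.
have -> : mu A = mu (A `&` range p).
  rewrite -[in LHS](setIT A) -(setvU (range p)) setIUr measureU.
  - rewrite [X in (X + _)%E](_ : _ = 0%E) ?add0e //.
    apply/eqP; rewrite eq_le measure_ge0 andbT -atoms_setC.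
    apply: le_measure; rewrite ?inE; [|exact: measurableC measurable_range|exact: subIsetr].
    by apply: measurableI => //; exact: measurableC measurable_range.
  - by apply: measurableI => //; exact: measurableC measurable_range.
  - by apply: measurableI => //; exact: measurable_range.
  - by rewrite setIACA setICl setI0.
rewrite range_bigsetU big_distrr /= measure_bigsetU_ord.
- apply: eq_bigr => k _; rewrite diracE; have [Ak|nAk] := boolP (p k \in A).
    rewrite mule1 -weightE; congr (mu _); apply/seteqP; split => [t []//|t tk].
    by split=> //; rewrite tk; move: Ak; rewrite inE.
  rewrite mule0 (_ : _ `&` _ = set0) ?measure0 //.
  by apply/seteqP; split => // t [At tk]; move: nAk; rewrite notin_setE -tk.
- by move=> k; apply: measurableI.
- by apply/trivIsetP => i j _ _ /eqP ij; apply/seteqP; split => // t [[_ ->] [_ /pinj]].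
Qed.


Lemma fine_measure_atoms A : measurable A ->
  fine (mu A) = \sum_k weight k * (p k \in A)%:R.
Proof.
move=> mA; rewrite (measure_atoms mA) (eq_bigr (fun k => (weight k * (p k \in A)%:R)%:E)).
  by rewrite sumEFin.
by move=> k _; rewrite diracE -EFinM.
Qed.

(** A simple function below [f] integrates to a sum over the atoms, which gives the
    upper bound; the combination of the indicators of the atoms with the values of
    [f] is measurable and below [f], which gives the lower bound. *)
Lemma ge0_integral_atoms (f : T -> R) : (forall t, 0 <= f t) ->
  (\int[mu]_t (f t)%:E = (\sum_k weight k * f (p k))%:E)%E.
Proof.
move=> f0; have [pinj mp _] := mu_atoms.
pose w k := NngNum (weight_ge0 k).
have mfE (g : T -> R) : (forall t, 0 <= g t) -> measurable_fun setT g ->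
    (\int[mu]_t (g t)%:E = (\sum_k weight k * g (p k))%:E)%E.
  move=> g0 mg; rewrite (@eq_measure_integral _ _ _ _ (atomic w p)) => [|A mA _].
    rewrite ge0_integral_atomic => [|//|]; last exact/measurable_EFinP.
    by rewrite -sumEFin; apply: eq_bigr => k _; rewrite EFinM.
  exact: etrans (measure_atoms mA) (esym (atomicE w p A)).
apply/eqP; rewrite eq_le; apply/andP; split.
  rewrite ge0_integralTE //; apply: ge_ereal_sup => _ [h /= hf <-].
  have -> : sintegral mu h = (\int[mu]_t (h t)%:E)%E.
    by rewrite integral_nnsfun // patch_setT.
  rewrite mfE // lee_fin; apply: ler_sum => k _.
  by rewrite ler_wpM2l ?weight_ge0 // -lee_fin.
pose g t := \sum_k f (p k) * \1_[set p k] t.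
have gp k : g (p k) = f (p k).
  rewrite /g (bigD1 k) //= indicE mem_set // mulr1 big1 ?addr0 // => j jk.
  rewrite indicE memNset ?mulr0 // => /pinj kj.
  by rewrite kj eqxx in jk.
have gf t : g t <= f t.
  have [[k _ <-]|tp] := pselect (range p t); first by rewrite gp.
  rewrite /g big1 // => k _; rewrite indicE memNset ?mulr0 // => tk.
  by apply: tp; exists k.
have g0 t : 0 <= g t by apply: sumr_ge0 => k _; rewrite mulr_ge0.
have mg : measurable_fun setT g.
  by apply: measurable_sum => k; apply: measurable_funM.
have <- : (\sum_k weight k * g (p k))%:E = (\sum_k weight k * f (p k))%:E.
  by congr (_%:E); apply: eq_bigr => k _; rewrite gp.
rewrite -mfE // !ge0_integralTE //; apply: le_ereal_sup.
move=> _ [h hg <-]; exists h => //= t; apply: le_trans (hg t) _.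
by rewrite lee_fin.
Qed.

Lemma integral_atoms (f : T -> R) :
  (\int[mu]_t (f t)%:E = (\sum_k weight k * f (p k))%:E)%E.
Proof.
have -> : (\int[mu]_t (f t)%:E = \int[mu]_t (Num.max (f t) 0)%:E
    - \int[mu]_t (Num.max (- f t) 0)%:E)%E.
  rewrite integralE; congr (_ - _)%E; apply: eq_integral => t _.
    by rewrite funeposE -EFin_max.
  by rewrite funenegE -EFinN -EFin_max.
have max0 (a : R) : 0 <= Num.max a 0 by rewrite le_max lexx orbT.
rewrite !ge0_integral_atoms // -EFinB -sumrB; congr (_%:E).
apply: eq_bigr => k _; rewrite -mulrBr; congr (_ * _).
by rewrite /Num.max; case: ifP; case: ifP; lra.
Qed.

Lemma sum_weight : \sum_k weight k = 1.
Proof.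
have := measure_atoms (@measurableT _ T); rewrite probability_setT.
rewrite (eq_bigr (fun k => (weight k)%:E)) => [|k _]; last by rewrite diracT mule1.
by rewrite sumEFin => -[].
Qed.

End AtomicMeasure.

(** * Couplings as points of the polytope *)

Section Pairing.
Context (R : realType) (n : nat) (x : 'cV[R]_n).
Implicit Types (h : 'I_n -> 'I_n -> R) (a b : 'I_n -> R).

(** The double integral of a function of two points against the square of the
    measure with masses [x]. *)
Definition pairing h := \sum_k \sum_k' x k 0 * x k' 0 * h k k'.

Lemma eq_pairing h h' : (forall k k', h k k' = h' k k') -> pairing h = pairing h'.
Proof.
by move=> hh; apply: eq_bigr => k _; apply: eq_bigr => k' _; rewrite hh.
Qed.

Lemma pairingD h h' :
  pairing (fun k k' => h k k' + h' k k') = pairing h + pairing h'.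
Proof.
rewrite /pairing -big_split; apply: eq_bigr => k _ /=.
by rewrite -big_split; apply: eq_bigr => k' _ /=; rewrite mulrDr.
Qed.

Lemma pairingZ c h : pairing (fun k k' => c * h k k') = c * pairing h.
Proof.
rewrite /pairing mulr_sumr; apply: eq_bigr => k _.
by rewrite mulr_sumr; apply: eq_bigr => k' _; ring.
Qed.

Lemma pairingC h : pairing (fun k k' => h k' k) = pairing h.
Proof.
rewrite /pairing exchange_big; apply: eq_bigr => k _; apply: eq_bigr => k' _.
by congr (_ * _); exact: mulrC.
Qed.

Lemma pairingE h : pairing h = \sum_k x k 0 * \sum_k' x k' 0 * h k k'.
Proof.
by apply: eq_bigr => k _; rewrite mulr_sumr; apply: eq_bigr => k' _; rewrite mulrA.
Qed.

Lemma pairingM a b :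
  pairing (fun k k' => a k * b k') = (\sum_k x k 0 * a k) * (\sum_k x k 0 * b k).
Proof.
rewrite pairingE mulr_suml; apply: eq_bigr => k _; rewrite !mulr_sumr.
by apply: eq_bigr => k' _; ring.
Qed.

Lemma quad_pairing (A : 'M[R]_n) : quad A x = pairing A.
Proof.
rewrite /quad mxE /pairing exchange_big; apply: eq_bigr => k _.
by rewrite mxE mulr_suml; apply: eq_bigr => k' _; rewrite !mxE; ring.
Qed.

End Pairing.

Section Couplings.
Context (R : realType) (d0 d1 : measure_display).
Context (X0 : measurableType d0) (X1 : measurableType d1).
Context (mu0 : probability X0 R) (mu1 : probability X1 R).
Context (N0 N1 : nat) (x0 : 'I_N0 -> X0) (x1 : 'I_N1 -> X1).
Hypothesis at0 : atoms mu0 x0.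
Hypothesis at1 : atoms mu1 x1.

Notation row k := (mxtens_unindex k).1.
Notation col k := (mxtens_unindex k).2.
Notation K := (polytope mu0 mu1 x0 x1).

Definition grid (k : 'I_(N0 * N1)) : X0 * X1 := (x0 (row k), x1 (col k)).

Lemma sum_mxtens (V : nmodType) (F : 'I_(N0 * N1) -> V) :
  \sum_k F k = \sum_m \sum_l F (mxtens_index (m, l)).
Proof.
rewrite pair_bigA /= (reindex (@mxtens_index N0 N1)) /=.
  by apply: eq_bigr => -[].
exists (@mxtens_unindex N0 N1) => k _; [exact: mxtens_indexK|exact: mxtens_unindexK].
Qed.

Lemma sum_row (F : 'I_(N0 * N1) -> R) m :
  \sum_k F k * (row k == m)%:R = \sum_l F (mxtens_index (m, l)).
Proof.
rewrite sum_mxtens (eq_bigr (fun m' =>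
    (m' == m)%:R * \sum_l F (mxtens_index (m', l)))) => [|m' _]; last first.
  by rewrite mulr_sumr; apply: eq_bigr => l _; rewrite mxtens_indexK mulrC.
by rewrite (bigD1 m) //= eqxx mul1r [X in _ + X]big1 ?addr0 // => m' /negPf ->; rewrite mul0r.
Qed.

Lemma sum_col (F : 'I_(N0 * N1) -> R) l :
  \sum_k F k * (col k == l)%:R = \sum_m F (mxtens_index (m, l)).
Proof.
rewrite sum_mxtens exchange_big (eq_bigr (fun l' =>
    (l' == l)%:R * \sum_m F (mxtens_index (m, l')))) => [|l' _]; last first.
  by rewrite mulr_sumr; apply: eq_bigr => m _; rewrite mxtens_indexK mulrC.
by rewrite (bigD1 l) //= eqxx mul1r [X in _ + X]big1 ?addr0 // => l' /negPf ->; rewrite mul0r.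
Qed.

Lemma grid_inj : injective grid.
Proof.
move=> k k' kk'; have [inj0 _ _] := at0; have [inj1 _ _] := at1.
have e0 : row k = row k' := inj0 _ _ (congr1 fst kk').
have e1 : col k = col k' := inj1 _ _ (congr1 snd kk').
apply: (can_inj (@mxtens_unindexK N0 N1)).
by rewrite [LHS]surjective_pairing [RHS]surjective_pairing e0 e1.
Qed.

Lemma measurable_grid k : measurable [set grid k].
Proof.
have -> : [set grid k] = [set x0 (row k)] `*` [set x1 (col k)].
  by apply/seteqP; split => [_ -> //|[s t] [/= -> ->]].
by apply: measurableX; [case: at0|case: at1].
Qed.

(** Two cylinders over null sets of the marginals cover the complement of the
    grid. *)
Lemma coupling_atoms pi : coupling mu0 mu1 pi -> atoms pi grid.
Proof.
move=> [pi0 pi1]; split; [exact: grid_inj|exact: measurable_grid|].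
have mrange : measurable (range grid).
  by rewrite range_bigsetU; apply: bigsetU_measurable => k _; exact: measurable_grid.
have mC0 : measurable (~` range x0) by apply: measurableC; exact: measurable_range at0.
have mC1 : measurable (~` range x1) by apply: measurableC; exact: measurable_range at1.
have m0 : measurable ((~` range x0) `*` [set: X1]) by apply: measurableX.
have m1 : measurable ([set: X0] `*` (~` range x1)) by apply: measurableX.
have z : pi (~` range grid) = 0%E.
  apply/eqP; rewrite eq_le measure_ge0 andbT.
  have : (~` range grid) `<=` (~` range x0) `*` setT `|` setT `*` (~` range x1).
    move=> [s t] nst; have [[m _ ms]|ns] := pselect (range x0 s); last by left.
    have [[l _ lt]|nt] := pselect (range x1 t); last by right.
    exfalso; apply: nst; exists (mxtens_index (m, l)) => //.
    by rewrite /grid mxtens_indexK /= ms lt.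
  move=> sub; apply: le_trans (le_measure pi _ _ sub) _; rewrite ?inE.
  - exact: measurableC.
  - exact: measurableU.
  apply: le_trans (measureU2 _ m0 m1) _; rewrite -[leRHS]adde0.
  by apply: leeD; rewrite le_eqVlt; apply/orP; left; apply/eqP;
    [exact: etrans (pi0 _ mC0) (atoms_setC at0)|
     exact: etrans (pi1 _ mC1) (atoms_setC at1)].
have := probability_setC pi (measurableC mrange); rewrite setCK z sube0.
exact.
Qed.

Lemma marginal0 x (g : 'I_N0 -> R) : K x ->
  \sum_k x k 0 * g (row k) = \sum_m weight mu0 x0 m * g m.
Proof.
move=> [_ s0 _]; rewrite sum_mxtens; apply: eq_bigr => m _.
rewrite /weight -s0 mulr_suml; apply: eq_bigr => l _.
by rewrite mxtens_indexK.
Qed.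

Lemma marginal1 x (g : 'I_N1 -> R) : K x ->
  \sum_k x k 0 * g (col k) = \sum_l weight mu1 x1 l * g l.
Proof.
move=> [_ _ s1]; rewrite sum_mxtens exchange_big; apply: eq_bigr => l _.
rewrite /weight -s1 mulr_suml; apply: eq_bigr => m _.
by rewrite mxtens_indexK.
Qed.

Lemma mass_polytope x : K x -> \sum_k x k 0 = 1.
Proof.
move=> Kx; transitivity (\sum_k x k 0 * 1); first by apply: eq_bigr => k _; rewrite mulr1.
rewrite (marginal0 (fun=> 1) Kx); apply: etrans (sum_weight at0).
by apply: eq_bigr => m _; rewrite mulr1.
Qed.

Lemma weight_coupling_vec (pi : probability (X0 * X1)%type R) k :
  coupling_vec x0 x1 pi k 0 = weight pi grid k.
Proof. by rewrite mxE. Qed.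

Lemma coupling_vec_polytope pi : coupling mu0 mu1 pi -> K (coupling_vec x0 x1 pi).
Proof.
move=> cpi; have atpi := coupling_atoms cpi; have [pi0 pi1] := cpi.
have [inj0 ms0 _] := at0; have [inj1 ms1 _] := at1.
split=> [k|m|l]; first by rewrite weight_coupling_vec weight_ge0.
- rewrite -pi0 // (fine_measure_atoms atpi); last exact: measurableX.
  rewrite -(sum_row (fun k => coupling_vec x0 x1 pi k 0)).
  apply: eq_bigr => k _; rewrite weight_coupling_vec.
  congr (_ * (nat_of_bool _)%:R); apply/idP/idP; rewrite inE /=; first by move=> /eqP <-.
  by move=> [/= /inj0 ->].
- rewrite -pi1 // (fine_measure_atoms atpi); last exact: measurableX.
  rewrite -(sum_col (fun k => coupling_vec x0 x1 pi k 0)).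
  apply: eq_bigr => k _; rewrite weight_coupling_vec.
  congr (_ * (nat_of_bool _)%:R); apply/idP/idP; rewrite inE /=; first by move=> /eqP <-.
  by move=> [/= _ /inj1 ->].
Qed.

Lemma polytope_coupling x : K x ->
  exists2 pi, coupling mu0 mu1 pi & coupling_vec x0 x1 pi = x.
Proof.
move=> Kx; have [xge0 _ _] := Kx.
have [pi piE] := atomic_probability grid xge0 (mass_polytope Kx).
exists pi; first split=> A mA.
- rewrite piE (measure_atoms at0 mA).
  rewrite (eq_bigr (fun k => (x k 0 * (x0 (row k) \in A)%:R)%:E)) => [|k _].
    rewrite sumEFin (marginal0 (fun m => (x0 m \in A)%:R) Kx) -sumEFin.
    by apply: eq_bigr => m _; rewrite EFinM diracE.
  rewrite diracE EFinM; congr (_ * _%:R%:E)%E; congr (nat_of_bool _).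
  by apply/idP/idP; rewrite !inE /= => //; case.
- rewrite piE (measure_atoms at1 mA).
  rewrite (eq_bigr (fun k => (x k 0 * (x1 (col k) \in A)%:R)%:E)) => [|k _].
    rewrite sumEFin (marginal1 (fun m => (x1 m \in A)%:R) Kx) -sumEFin.
    by apply: eq_bigr => m _; rewrite EFinM diracE.
  rewrite diracE EFinM; congr (_ * _%:R%:E)%E; congr (nat_of_bool _).
  by apply/idP/idP; rewrite !inE /= => //; case.
apply/matrixP => k j; rewrite ord1 mxE piE (bigD1 k) //= big1 => [|k' k'k].
  by rewrite adde0 diracE mem_set //= mulr1.
by rewrite diracE memNset ?mule0 //= => /grid_inj kk; rewrite kk eqxx in k'k.
Qed.

Lemma polytope_affine : exists (A : 'M[R]_(N0 + N1, N0 * N1)) b,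
  forall x, K x <-> (forall k, 0 <= x k 0) /\ A *m x = b.
Proof.
exists (col_mx (\matrix_(m < N0, k < N0 * N1) (row k == m)%:R)
  (\matrix_(l < N1, k < N0 * N1) (col k == l)%:R)).
exists (col_mx (\col_m fine (mu0 [set x0 m])) (\col_l fine (mu1 [set x1 l]))).
have rowE (x : 'cV[R]_(N0 * N1)) m : (\matrix_(m < N0, k < N0 * N1) (row k == m)%:R *m x) m 0 =
    \sum_(l < N1) x (mxtens_index (m, l)) 0 :> R.
  rewrite mxE -(sum_row (fun k => x k 0)); apply: eq_bigr => k _; by rewrite mxE mulrC.
have colE (x : 'cV[R]_(N0 * N1)) l : (\matrix_(l < N1, k < N0 * N1) (col k == l)%:R *m x) l 0 =
    \sum_(m < N0) x (mxtens_index (m, l)) 0 :> R.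
  rewrite mxE -(sum_col (fun k => x k 0)); apply: eq_bigr => k _; by rewrite mxE mulrC.
move=> x; rewrite mul_col_mx; split=> [[x0' s0 s1]|[x0' /eq_col_mx[e0 e1]]].
  split=> //; congr col_mx; apply/matrixP => i j; rewrite ord1.
    by rewrite rowE s0 mxE.
  by rewrite colE s1 mxE.
by split=> // [m|l]; [rewrite -rowE e0 mxE|rewrite -colE e1 mxE].
Qed.

Context (k0 : X0 -> X0 -> R) (k1 : X1 -> X1 -> R) (q : nat).

Definition distortion (z z' : X0 * X1) : R :=
  `|k0 z.1 z'.1 ^+ q - k1 z.2 z'.2 ^+ q| ^+ 2.

Lemma gw_cost_pairing pi : coupling mu0 mu1 pi ->
  gw_cost k0 k1 q pi =
    (pairing (coupling_vec x0 x1 pi) (fun k k' => distortion (grid k) (grid k')))%:E.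
Proof.
move=> /coupling_atoms atpi; rewrite /gw_cost.
have d_ge0 z z' : 0 <= distortion z z' by rewrite exprn_ge0.
have inner z : (\int[pi]_z' (distortion z z')%:E =
    (\sum_k' weight pi grid k' * distortion z (grid k'))%:E)%E.
  exact: ge0_integral_atoms.
under eq_integral do rewrite [integral _ _ _]inner.
rewrite (ge0_integral_atoms atpi) => [|z].
  rewrite pairingE; congr (_%:E); apply: eq_bigr => k _; rewrite mxE.
  by congr (_ * _); apply: eq_bigr => k' _; rewrite mxE.
by apply: sumr_ge0 => k' _; rewrite mulr_ge0 ?weight_ge0.
Qed.

Lemma pairing_row x (g : 'I_N0 -> 'I_N0 -> R) : K x ->
  pairing x (fun k k' => g (row k) (row k')) =
  \sum_m weight mu0 x0 m * \sum_m' weight mu0 x0 m' * g m m'.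
Proof.
move=> Kx; rewrite pairingE -(marginal0 _ Kx); apply: eq_bigr => k _.
by rewrite -(marginal0 (g (row k)) Kx).
Qed.

Lemma pairing_col x (g : 'I_N1 -> 'I_N1 -> R) : K x ->
  pairing x (fun k k' => g (col k) (col k')) =
  \sum_l weight mu1 x1 l * \sum_l' weight mu1 x1 l' * g l l'.
Proof.
move=> Kx; rewrite pairingE -(marginal1 _ Kx); apply: eq_bigr => k _.
by rewrite -(marginal1 (g (col k)) Kx).
Qed.

Lemma quad_Mmx x : quad (Mmx k0 k1 q x0 x1) x = 4 * pairing x (fun k k' =>
  k0 (x0 (row k)) (x0 (row k')) ^+ q * k1 (x1 (col k)) (x1 (col k')) ^+ q).
Proof. by rewrite quad_pairing -pairingZ; apply: eq_pairing => k k'; rewrite !mxE. Qed.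

(** Expanding the square in the distortion, the pure terms only see the marginals
    and are constant on the polytope; the cross term is the quadratic form of
    [Mmx]. *)
Lemma gw_cost_affine : exists a, forall pi, coupling mu0 mu1 pi ->
  gw_cost k0 k1 q pi =
    (a - 2^-1 * quad (Mmx k0 k1 q x0 x1) (coupling_vec x0 x1 pi))%:E.
Proof.
pose f m m' := (k0 (x0 m) (x0 m') ^+ q) ^+ 2.
pose g l l' := (k1 (x1 l) (x1 l') ^+ q) ^+ 2.
exists (\sum_m weight mu0 x0 m * (\sum_m' weight mu0 x0 m' * f m m') +
  \sum_l weight mu1 x1 l * (\sum_l' weight mu1 x1 l' * g l l')) => pi cpi.
have Kx := coupling_vec_polytope cpi.
rewrite gw_cost_pairing // -(pairing_row f Kx) -(pairing_col g Kx) quad_Mmx.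
congr (_%:E); rewrite mulrA -mulNr -pairingZ -!pairingD; apply: eq_pairing => k k'.
by rewrite /distortion /f /g real_normK ?num_real //=; field.
Qed.

End Couplings.

(** * The finite and the Euclidean settings *)

Section Settings.
Context (R : realType).

Lemma finite_discrete_atoms (d : measure_display) (X : measurableType d)
    (mu : probability X R) N (x : 'I_N -> X) :
  finite_discrete X -> bijective x -> atoms mu x.
Proof.
move=> [_ mX] bx; split; [exact: bij_inj|by move=> k; exact: mX|].
rewrite (_ : range x = setT) ?probability_setT //.
by case: bx => y _ yx; apply/seteqP; split => // t _; exists (y t).
Qed.

Lemma measurable_point d (a : Rd R d) : measurable [set a].
Proof.
rewrite -[X in measurable X]setCK; apply: measurableC; apply: sub_sigma_algebra.
rewrite /= openC; apply: accessible_closed_set1; apply: hausdorff_accessible.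
exact: norm_hausdorff.
Qed.

Lemma support_points_atoms d (mu : probability (Rd R d) R) N (x : 'I_N -> Rd R d) :
  support_points mu x -> atoms mu x.
Proof. by move=> [xinj _ mu1]; split=> // k; exact: measurable_point. Qed.

Lemma centered_dotv d (mu : probability (Rd R d) R) N (x : 'I_N -> Rd R d) y :
  centered mu -> atoms mu x ->
  \sum_k weight mu x k * dotv (y : 'cV[R]_d) (x k : 'cV[R]_d) = 0.
Proof.
move=> cmu atx.
under eq_bigr do rewrite dotvE mulr_sumr.
rewrite exchange_big big1 // => i _.
have [_] := cmu i; rewrite (integral_atoms atx) => -[mean0].
transitivity (y i 0 * \sum_k weight mu x k * (x k : 'cV[R]_d) i 0).
  by rewrite mulr_sumr; apply: eq_bigr => k _; rewrite mulrCA.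
by rewrite mean0 mulr0.
Qed.

Section Euclidean.
Context (n0 n1 : nat) (mu0 : probability (Rd R n0) R) (mu1 : probability (Rd R n1) R).
Context (N0 N1 : nat) (x0 : 'I_N0 -> Rd R n0) (x1 : 'I_N1 -> Rd R n1).
Hypothesis ctr0 : centered mu0.
Hypothesis ctr1 : centered mu1.
Hypothesis at0 : atoms mu0 x0.
Hypothesis at1 : atoms mu1 x1.

Notation row k := (mxtens_unindex k).1.
Notation col k := (mxtens_unindex k).2.
Notation K := (polytope mu0 mu1 x0 x1).
Notation p0 k := (x0 (row k) : 'cV[R]_n0).
Notation p1 k := (x1 (col k) : 'cV[R]_n1).
Notation s0 k := (dotv (p0 k) (p0 k)).
Notation s1 k := (dotv (p1 k) (p1 k)).

(** Integrating out the second point replaces it by the mean of the first marginal,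
    which is zero. *)
Lemma pairing_linear0 x (a : 'I_(N0 * N1) -> R) : K x ->
  pairing x (fun k k' => a k * dotv (p0 k) (p0 k')) = 0.
Proof.
move=> Kx; rewrite pairingE big1 // => k _.
rewrite (eq_bigr (fun k' => a k * (x k' 0 * dotv (p0 k) (p0 k')))) => [|k' _].
  rewrite -mulr_sumr (marginal0 (fun m => dotv (p0 k) (x0 m)) Kx).
  by rewrite centered_dotv // !mulr0.
by rewrite mulrCA.
Qed.

Lemma pairing_linear1 x (a : 'I_(N0 * N1) -> R) : K x ->
  pairing x (fun k k' => a k * dotv (p1 k) (p1 k')) = 0.
Proof.
move=> Kx; rewrite pairingE big1 // => k _.
rewrite (eq_bigr (fun k' => a k * (x k' 0 * dotv (p1 k) (p1 k')))) => [|k' _].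
  rewrite -mulr_sumr (marginal1 (fun m => dotv (p1 k) (x1 m)) Kx).
  by rewrite centered_dotv // !mulr0.
by rewrite mulrCA.
Qed.

(** The product of the squared distances, expanded: the terms that involve a
    single scalar product integrate to zero because the marginals are centred,
    the product of squared norms at distinct points only sees the marginals, and
    what remains is the linear part and the product of the Gram matrices. *)
Lemma euclidean_reduction : exists a, forall x, K x ->
  - (2^-1 * quad (Mmx (@euclidean_kernel R n0) (@euclidean_kernel R n1) 2 x0 x1) x) =
  a + (dotv (\col_k (- 4 * enorm (x0 (mxtens_unindex k).1 : 'cV[R]_n0) ^+ 2
                   * enorm (x1 (mxtens_unindex k).2 : 'cV[R]_n1) ^+ 2)) x
       - 2^-1 * quad (16 *: tensmx (gram x0) (gram x1)) x).
Proof.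
pose m0 := \sum_m weight mu0 x0 m * dotv (x0 m : 'cV[R]_n0) (x0 m : 'cV[R]_n0).
pose m1 := \sum_l weight mu1 x1 l * dotv (x1 l : 'cV[R]_n1) (x1 l : 'cV[R]_n1).
exists (- 4 * (m0 * m1)) => x Kx.
pose G (k k' : 'I_(N0 * N1)) := dotv (p0 k) (p0 k').
pose H (k k' : 'I_(N0 * N1)) := dotv (p1 k) (p1 k').
pose P := pairing x.
have GC k k' : G k k' = G k' k by exact: dotvC.
have HC k k' : H k k' = H k' k by exact: dotvC.
have e1 : P (fun k _ => s0 k * s1 k * 1) = \sum_k x k 0 * (s0 k * s1 k).
  rewrite /P (pairingM x (fun k => s0 k * s1 k) (fun=> 1)).
  rewrite (_ : \sum_k x k 0 * 1 = 1) ?mulr1 // -(mass_polytope at0 Kx).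
  by apply: eq_bigr => k _; rewrite (mass_polytope at0 Kx) mulr1.
have e2 : P (fun k k' => s0 k * s1 k') = m0 * m1.
  rewrite /P pairingM (marginal0 (fun m => dotv (x0 m : 'cV[R]_n0) (x0 m)) Kx).
  by rewrite (marginal1 (fun l => dotv (x1 l : 'cV[R]_n1) (x1 l)) Kx).
have z0 a : P (fun k k' => a k * G k k') = 0 := pairing_linear0 a Kx.
have z1 a : P (fun k k' => a k * H k k') = 0 := pairing_linear1 a Kx.
have sym h : P (fun k k' => h k k' + h k' k) = 2 * P h.
  by rewrite /P pairingD pairingC mulr2n mulrDl mul1r.
have comb h1 h2 h3 h4 h5 : P (fun k k' => (h1 k k' + h2 k k') +
    ((- 2 * h3 k k' + - 2 * h4 k k') + 4 * h5 k k')) =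
    (P h1 + P h2) + ((- 2 * P h3 + - 2 * P h4) + 4 * P h5).
  by rewrite /P 4!pairingD !pairingZ.
have -> : quad (Mmx (@euclidean_kernel R n0) (@euclidean_kernel R n1) 2 x0 x1) x =
    4 * ((P (fun k k' => s0 k * s1 k * 1 + s0 k' * s1 k' * 1)
          + P (fun k k' => s0 k * s1 k' + s0 k' * s1 k))
      + ((- 2 * P (fun k k' => s0 k * H k k' + s0 k' * H k' k)
          + - 2 * P (fun k k' => s1 k * G k k' + s1 k' * G k' k))
        + 4 * P (fun k k' => G k k' * H k k'))).
  rewrite quad_Mmx -comb; congr (4 * _); apply: eq_pairing => k k'.
  rewrite /euclidean_kernel !sqr_enorm (HC k' k) (GC k' k) /H /G !dotvD.
  rewrite (dotvC (p0 k') (p0 k)) (dotvC (p1 k') (p1 k)); ring.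
rewrite (sym (fun k _ => s0 k * s1 k * 1)) (sym (fun k k' => s0 k * s1 k')).
rewrite (sym (fun k k' => s0 k * H k k')) (sym (fun k k' => s1 k * G k k')).
rewrite e1 e2 z0 z1 quad_pairing.
have -> : pairing x (fun k k' => (16 *: tensmx (gram x0) (gram x1)) k k')
    = 16 * P (fun k k' => G k k' * H k k').
  by rewrite -pairingZ; apply: eq_pairing => k k'; rewrite !mxE.
have -> : dotv (\col_k (- 4 * enorm (p0 k) ^+ 2 * enorm (p1 k) ^+ 2)) x
    = - 4 * (\sum_k x k 0 * (s0 k * s1 k)).
  by rewrite dotvE mulr_sumr; apply: eq_bigr => k _; rewrite mxE !sqr_enorm; ring.
by field.
Qed.

End Euclidean.

(** The two settings enter the argument only through this lemma: the measures are
    carried by the given points, and on the polytope the objective is the concave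
    quadratic given by [Q] and [c], up to a constant. *)
Lemma gw_setting_reduction (d0 d1 : measure_display)
    (X0 : measurableType d0) (X1 : measurableType d1)
    (k0 : X0 -> X0 -> R) (k1 : X1 -> X1 -> R) (q : nat)
    (mu0 : probability X0 R) (mu1 : probability X1 R)
    (N0 N1 : nat) (x0 : 'I_N0 -> X0) (x1 : 'I_N1 -> X1)
    (Q : 'M[R]_(N0 * N1)) (c : 'cV[R]_(N0 * N1)) :
  gw_setting k0 k1 q mu0 mu1 x0 x1 Q c ->
  [/\ atoms mu0 x0, atoms mu1 x1 & exists a, forall x, polytope mu0 mu1 x0 x1 x ->
    - (2^-1 * quad (Mmx k0 k1 q x0 x1) x) = a + (dotv c x - 2^-1 * quad Q x)].
Proof.
case=> [e0 e1 Y0 Y1 h0 h1 p nu0 nu1 M0 M1 y0 y1 fin0 fin1 _ _ b0 b1|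
  n0 n1 nu0 nu1 M0 M1 y0 y1 c0 c1 sp0 sp1].
  split; [exact: finite_discrete_atoms|exact: finite_discrete_atoms|].
  by exists 0 => x _; rewrite /dotv trmx0 mul0mx mxE !add0r.
have at0 := support_points_atoms sp0; have at1 := support_points_atoms sp1.
by split=> //; exact: euclidean_reduction.
Qed.

End Settings.

(** * Convergence of entropic Gromov-Wasserstein couplings *)

Theorem corollary2 (R : realType) (d0 d1 : measure_display)
    (X0 : measurableType d0) (X1 : measurableType d1)
    (k0 : X0 -> X0 -> R) (k1 : X1 -> X1 -> R) (q : nat)
    (mu0 : probability X0 R) (mu1 : probability X1 R)
    (N0 N1 : nat) (x0 : 'I_N0 -> X0) (x1 : 'I_N1 -> X1)
    (Q : 'M[R]_(N0 * N1)) (c : 'cV[R]_(N0 * N1))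
    (r : nat) (B : 'M[R]_(r, N0 * N1))
    (nV : nat) (v : 'I_nV -> 'cV[R]_(N0 * N1)) :
  let K := polytope mu0 mu1 x0 x1 in
  let f := fun x : 'cV[R]_(N0 * N1) => - (2^-1 * quad (Mmx k0 k1 q x0 x1) x) in
  gw_setting k0 k1 q mu0 mu1 x0 x1 Q c ->
  (r <= N0 * N1)%N -> Q = B^T *m B ->
  injective v -> range v = vertices K ->
  (exists x y, [/\ K x, K y & f x <> f y]) ->
  forall eps : R, 0 < eps -> (eps%:E < eps_bar K c B v)%E ->
  (forall x : 'cV[R]_(N0 * N1),
     argmin K (fun y => f y - eps * entropy y) x ->
     (dist x (argmin K f)
      <= (C_1 K)%:E * expeR (- (C_2 K c B v * (eps^-1)%:E)))%E) /\
  (forall pi : probability (X0 * X1)%type R,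
     coupling mu0 mu1 pi ->
     egw_objective k0 k1 q x0 x1 eps pi = EGW k0 k1 q mu0 mu1 x0 x1 eps ->
     (0 <= gw_cost k0 k1 q pi - GW k0 k1 q mu0 mu1 ^+ 2)%E /\
     (gw_cost k0 k1 q pi - GW k0 k1 q mu0 mu1 ^+ 2
      <= (C_1' K c Q)%:E * expeR (- (C_2 K c B v * (eps^-1)%:E)))%E).
Proof.
move=> K f setting _ QE _ vrange [x1' [_ [Kx1' _ _]]] eps eps_gt0 eps_lt.
have [at0 at1 [a fE]] := gw_setting_reduction setting.
have [A [b KP]] := polytope_affine mu0 mu1 x0 x1.
have massK x : K x -> \sum_k x k 0 = 1 by move=> Kx; exact: (mass_polytope at0 Kx).
have K_ge0 x k : K x -> 0 <= x k 0 by case.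
have vertK k : vertices K (v k) by rewrite -vrange; exists k.
have hullK x : K x <-> hull v predT x.
  split; first by apply: (polytope_sub_hull KP massK); rewrite vrange.
  by apply: (hull_subK KP) => k; case: (vertK k).
pose F := concave_obj c B.
have objE x : K x -> f x = a + F x.
  by move=> Kx; rewrite /f fE // QE quad_gram.
have argminE : argmin K f = argmin K F.
  apply/seteqP; split=> x [Kx xmin]; split=> // y Ky; have := xmin y Ky.
    by rewrite !objE // lerD2l.
  by rewrite !objE // lerD2l.
have optE x : argmin K (fun y => f y - eps * entropy y) x ->
    argmin K (fun y => F y - eps * entropy y) x.
  move=> [Kx xmin]; split=> // y Ky; have := xmin y Ky.
  by rewrite !objE // -!addrA lerD2l.
split=> [x /optE xopt|pi cpi piopt].
  rewrite argminE.
  exact: (dist_rate ltr01 K_ge0 massK hullK vertK eps_gt0 eps_lt xopt).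
have [C costE] := gw_cost_affine at0 at1 k0 k1 q.
have objectiveE pi' : coupling mu0 mu1 pi' ->
    egw_objective k0 k1 q x0 x1 eps pi' =
    (C + (f (coupling_vec x0 x1 pi') - eps * entropy (coupling_vec x0 x1 pi')))%:E.
  by move=> cpi'; rewrite /egw_objective costE // -EFinB addrA.
pose x := coupling_vec x0 x1 pi.
have Kx : K x by exact: coupling_vec_polytope.
have xopt : argmin K (fun y => f y - eps * entropy y) x.
  split=> // y /(polytope_coupling at0 at1)[pi' cpi' <-].
  rewrite -(lerD2l C) -lee_fin -!objectiveE // piopt.
  by apply: ereal_inf_lbound; exists pi'.
have [y ymin cost] :=
  cost_rate ltr01 K_ge0 massK hullK vertK eps_gt0 eps_lt (optE x xopt).
have [Ky ymin_f] : argmin K f y by rewrite argminE.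
have cost_ge0 pi' : (0 <= gw_cost k0 k1 q pi')%E.
  apply: integral_ge0 => z _; apply: integral_ge0 => z' _.
  by rewrite lee_fin exprn_ge0.
have [piy cpiy yE] := polytope_coupling at0 at1 Ky.
have infE : ereal_inf [set gw_cost k0 k1 q pi' | pi' in coupling mu0 mu1] = (C + f y)%:E.
  apply/eqP; rewrite eq_le; apply/andP; split.
    by apply: ereal_inf_lbound; exists piy; rewrite ?costE ?yE.
  apply: le_ereal_inf_tmp => _ [pi' cpi' <-]; rewrite costE // lee_fin lerD2l.
  exact/ymin_f/coupling_vec_polytope.
have GW2 : (GW k0 k1 q mu0 mu1 ^+ 2 = (C + f y)%:E)%E.
  have : (0 <= (C + f y)%:E)%E.
    by rewrite -infE; apply: le_ereal_inf_tmp => _ [pi' _ <-].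
  rewrite lee_fin => ge0.
  by rewrite /GW infE poweR_EFin -EFin_expe powR12_sqrt // sqr_sqrtr.
have diffE : (gw_cost k0 k1 q pi - GW k0 k1 q mu0 mu1 ^+ 2 = (F x - F y)%:E)%E.
  rewrite GW2 costE // -EFinB; congr (_%:E).
  rewrite -[- (2^-1 * _)]/(f x) !objE //; ring.
rewrite diffE; split; first by rewrite lee_fin subr_ge0; case: ymin => _; apply.
by rewrite QE.
Qed.
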